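(* Let $X$ be a smooth complex projective variety of complex dimension $m$ and $n\ge2$. Let $x_{h_1}\in\mathcal{B}$, let $x_{h_2}\succ\dots\succ x_{h_t}$ be distinct elements of $\mathcal{B}$ ($h_1$ may be equal to one of $h_2,\dots,h_t$), and let $m_2,\dots,m_t\ge1$ be integers with $2+m_2+\dots+m_t=n$. For the type $L_*=(2,1^{(n-2)})$, $H_*=(h_1;h_2^{(m_2)},\dots,h_t^{(m_t)})$ there is an isomorphism of $\mathcal{S}_n$-modules $$E_1^{2m-1+|H_*|}(L_*,H_* )\cong\mathrm{Ind}^{\mathcal{S}_n}_{\mathcal{S}_2\times\mathcal{S}_{m_2}\times\dots\times\mathcal{S}_{m_t}}V(2)\otimes V^{\epsilon(m_2,h_2)}\otimes\dots\otimes V^{\epsilon(m_t,h_t)}.$$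
   Context: $X$ is connected of complex dimension $m\ge1$, $H^*(X)=H^*(X;\mathbb{Q})$, and $\mathcal{B}=\{x_1=1\prec\dots\prec x_B=w\}$ is a fixed homogeneous ordered basis of $H^*(X)$ with nondecreasing degrees, $w\in H^{2m}(X)$ the fundamental class; $|x_h|=\deg x_h$. $p_i^*:H^*(X)\to H^*(X^n)$ is the pullback along the $i$-th projection. As a bigraded algebra, the Kriz model $E(X,n)$ is the graded-commutative algebra obtained from the exterior algebra with generators $G_{ij}$ ($1\le i\neq j\le n$) of degree $2m-1$ and coefficients in $H^*(X)^{\otimes n}$, modulo $G_{ji}=G_{ij}$; $p_j^*(x)G_{ij}=p_i^*(x)G_{ij}$ ($i<j$, $x\in H^*(X)$); $G_{ik}G_{jk}=G_{ij}G_{jk}-G_{ij}G_{ik}$ ($i<j<k$). $E_q^k(X,n)$ is the part with $q$ exterior generators and total degree $k$. $\mathcal{S}_n$ acts by algebra automorphisms with $\sigma(p_i^*(x))=p_{\sigma(i)}^*(x)$, $\sigma(G_{ij})=G_{\sigma(i)\sigma(j)}$. $h^{(r)}$ means $h$ repeated $r$ times; $|H_*|=|x_{h_1}|+\sum_{i\ge2}m_i|x_{h_i}|$. $E_1^{2m-1+|H_*|}(L_*,H_* )$ is the linear span of the monomials $p_1^*(x_{a_1})\cdots p_n^*(x_{a_n})G_{ij}$, $i<j$, such that $x_{a_i}=x_{h_1}$, $x_{a_j}=1$, and among the remaining $n-2$ positions exactly $m_l$ carry the class $x_{h_l}$, for $l=2,\dots,t$. $V(\lambda)$ is the irreducible module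 of the symmetric group attached to the partition $\lambda$ ($V(r)$ trivial, $V(1,\dots,1)$ sign), and for $r\geq 1$, $V^{\epsilon(r,h)}$ is the $\mathcal{S}_r$-module $V(r)$ if $r=1$ or $|x_h|$ is even, and $V(1,1,\dots,1)$ if $r\ge2$ and $|x_h|$ is odd. The inducing subgroup is the standard Young subgroup of $\mathcal{S}_n$. *)

(* Defs.v *)
From HB Require Import structures.
From mathcomp Require Import all_boot all_order all_algebra.
From mathcomp Require Import all_fingroup all_solvable all_field all_character.
From mathcomp Require Import boolp.

Set Implicit Arguments.
Unset Strict Implicit.
Unset Printing Implicit Defensive.

Import GRing.Theory.
Local Open Scope ring_scope.
Local Open Scope quotient_scope.

Inductive aterm (F : fieldType) (gen : Type) : Type :=
| Agen of gen
| Azero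
| Aone
| Aadd of aterm F gen & aterm F gen
| Ascale of F & aterm F gen
| Amul of aterm F gen & aterm F gen.

Arguments Azero {F gen}.
Arguments Aone {F gen}.
Arguments Agen {F gen} _.

HB.instance Definition _ (F : fieldType) gen := gen_eqMixin (aterm F gen).
HB.instance Definition _ (F : fieldType) gen := gen_choiceMixin (aterm F gen).

Declare Scope aterm_scope.
Delimit Scope aterm_scope with A.
Bind Scope aterm_scope with aterm.
Infix "+" := Aadd : aterm_scope.
Infix "*" := Amul : aterm_scope.
Infix "*:" := Ascale : aterm_scope.
Notation "0" := Azero : aterm_scope.
Notation "1" := Aone : aterm_scope.

Section Presented.

Variables (F : fieldType) (gen : Type).
Local Notation term := (aterm F gen).
Variable rel : term -> term -> Prop.

(* The least congruence containing rel whose quotient is an F-algebra; the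
   quotient is the free algebra on gen modulo the two-sided ideal generated by
   the differences s - t with rel s t. *)
Inductive acong : term -> term -> Prop :=
| acong_rel s t : rel s t -> acong s t
| acong_refl s : acong s s
| acong_sym s t : acong s t -> acong t s
| acong_trans s t u : acong s t -> acong t u -> acong s u
| acong_add s s' t t' : acong s s' -> acong t t' -> acong (s + t)%A (s' + t')%A
| acong_scale a s s' : acong s s' -> acong (a *: s)%A (a *: s')%A
| acong_mul s s' t t' : acong s s' -> acong t t' -> acong (s * t)%A (s' * t')%A
| acong_addA s t u : acong (s + (t + u))%A (s + t + u)%A
| acong_addC s t : acong (s + t)%A (t + s)%A
| acong_add0 s : acong (0 + s)%A s
| acong_addN s : acong ((- (1 : F)) *: s + s)%A 0%A
| acong_scaleA a b s : acong (a *: (b *: s))%A ((a * b)%R *: s)%A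
| acong_scale1 s : acong ((1 : F) *: s)%A s
| acong_scaleDr a s t : acong (a *: (s + t))%A (a *: s + a *: t)%A
| acong_scaleDl a b s : acong ((a + b)%R *: s)%A (a *: s + b *: s)%A
| acong_mulA s t u : acong (s * (t * u))%A (s * t * u)%A
| acong_1mul s : acong (1 * s)%A s
| acong_mul1 s : acong (s * 1)%A s
| acong_mulDl s t u : acong ((s + t) * u)%A (s * u + t * u)%A
| acong_mulDr s t u : acong (s * (t + u))%A (s * t + s * u)%A
| acong_scaleAl a s t : acong (a *: (s * t))%A ((a *: s) * t)%A
| acong_scaleAr a s t : acong (a *: (s * t))%A (s * (a *: t))%A.

Definition acongb (s t : term) : bool := `[< acong s t >].

Lemma acongb_is_equiv : equiv_class_of acongb.
Proof.
split=> [s | s t | t s u].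
- by apply/asboolP; apply: acong_refl.
- by apply/asboolP/asboolP; apply: acong_sym.
- by move=> /asboolP st /asboolP tu; apply/asboolP; apply: acong_trans st tu.
Qed.

Canonical acong_equiv := EquivRelPack acongb_is_equiv.
Canonical acong_encModRel := defaultEncModRel acongb.

Definition presented := {eq_quot acongb}.
HB.instance Definition _ := Choice.on presented.
HB.instance Definition _ : EqQuotient _ acongb presented :=
  EqQuotient.on presented.

Definition cls (s : term) : presented := \pi_presented s.

Lemma clsP s t : cls s = cls t <-> acong s t.
Proof.
split=> [/eqP|st]; first by rewrite eqmodE => /asboolP.
by apply/eqP; rewrite eqmodE; apply/asboolP.
Qed.

Lemma clsK (q : presented) : cls (generic_quotient.repr q) = q.
Proof. exact: reprK. Qed.

Lemma cls_repr s : acong (generic_quotient.repr (cls s)) s.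
Proof. by apply/clsP; rewrite clsK. Qed.

Definition pzero := cls 0.
Definition pone := cls 1.
Definition padd (p q : presented) := cls (generic_quotient.repr p + generic_quotient.repr q).
Definition pscale a (p : presented) := cls (a *: generic_quotient.repr p).
Definition pmul (p q : presented) := cls (generic_quotient.repr p * generic_quotient.repr q).
Definition popp := pscale (-1).

Lemma cls_add s t : cls (s + t) = padd (cls s) (cls t).
Proof. by apply/clsP/acong_sym; apply: acong_add; apply: cls_repr. Qed.
Lemma cls_scale a s : cls (a *: s) = pscale a (cls s).
Proof. by apply/clsP/acong_sym; apply: acong_scale; apply: cls_repr. Qed.
Lemma cls_mul s t : cls (s * t) = pmul (cls s) (cls t).
Proof. by apply/clsP/acong_sym; apply: acong_mul; apply: cls_repr. Qed.

Let clsE := (cls_add, cls_scale, cls_mul).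

Fact paddA : associative padd.
Proof.
move=> p q r; rewrite -[p]clsK -[q]clsK -[r]clsK -!clsE.
exact/clsP/acong_addA.
Qed.
Fact paddC : commutative padd.
Proof. by move=> p q; rewrite -[p]clsK -[q]clsK -!clsE; apply/clsP/acong_addC. Qed.
Fact padd0 : left_id pzero padd.
Proof. by move=> p; rewrite -[p]clsK -!clsE; apply/clsP/acong_add0. Qed.
Fact paddN : left_inverse pzero popp padd.
Proof. by move=> p; rewrite -[p]clsK /popp -!clsE; apply/clsP/acong_addN. Qed.

HB.instance Definition _ :=
  GRing.isZmodule.Build presented paddA paddC padd0 paddN.

Fact pmulA : associative pmul.
Proof.
move=> p q r; rewrite -[p]clsK -[q]clsK -[r]clsK -!clsE.
exact/clsP/acong_mulA.
Qed.
Fact p1mul : left_id pone pmul.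
Proof. by move=> p; rewrite -[p]clsK -!clsE; apply/clsP/acong_1mul. Qed.
Fact pmul1 : right_id pone pmul.
Proof. by move=> p; rewrite -[p]clsK -!clsE; apply/clsP/acong_mul1. Qed.
Fact pmulDl : left_distributive pmul +%R.
Proof.
move=> p q r; rewrite -[p]clsK -[q]clsK -[r]clsK -[_ + _]/(padd _ _).
by rewrite -[RHS]/(padd _ _) -!clsE; apply/clsP/acong_mulDl.
Qed.
Fact pmulDr : right_distributive pmul +%R.
Proof.
move=> p q r; rewrite -[p]clsK -[q]clsK -[r]clsK -[_ + _]/(padd _ _).
by rewrite -[RHS]/(padd _ _) -!clsE; apply/clsP/acong_mulDr.
Qed.

HB.instance Definition _ :=
  GRing.Zmodule_isPzRing.Build presented pmulA p1mul pmul1 pmulDl pmulDr.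

Fact pscaleA a b p : pscale a (pscale b p) = pscale (a * b) p.
Proof. by rewrite -[p]clsK -!clsE; apply/clsP/acong_scaleA. Qed.
Fact pscale1 : left_id 1 pscale.
Proof. by move=> p; rewrite -[p]clsK -!clsE; apply/clsP/acong_scale1. Qed.
Fact pscaleDr : right_distributive pscale +%R.
Proof.
move=> a p q; rewrite -[p]clsK -[q]clsK -[_ + _]/(padd _ _).
by rewrite -[RHS]/(padd _ _) -!clsE; apply/clsP/acong_scaleDr.
Qed.
Fact pscaleDl p : {morph pscale^~ p : a b / a + b}.
Proof.
move=> a b /=; rewrite -[p]clsK -[RHS]/(padd _ _) -!clsE.
exact/clsP/acong_scaleDl.
Qed.

HB.instance Definition _ := GRing.Zmodule_isLmodule.Build F presented
  pscaleA pscale1 pscaleDr pscaleDl.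

Lemma clsD s t : cls (s + t) = cls s + cls t. Proof. exact: cls_add. Qed.
Lemma clsZ a s : cls (a *: s) = a *: cls s. Proof. exact: cls_scale. Qed.
Lemma clsM s t : cls (s * t) = cls s * cls t. Proof. exact: cls_mul. Qed.
Lemma cls0 : cls 0 = 0. Proof. by []. Qed.
Lemma cls1 : cls 1 = 1. Proof. by []. Qed.

Lemma presented_scaleAl a (p q : presented) : a *: (p * q) = (a *: p) * q.
Proof.
rewrite -[p]clsK -[q]clsK; set s := generic_quotient.repr p.
set t := generic_quotient.repr q.
rewrite -(clsM s t) -(clsZ a s) -(clsZ a (s * t)%A) -(clsM (a *: s)%A t).
exact/clsP/acong_scaleAl.
Qed.
Lemma presented_scaleAr a (p q : presented) : a *: (p * q) = p * (a *: q).
Proof.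
rewrite -[p]clsK -[q]clsK; set s := generic_quotient.repr p.
set t := generic_quotient.repr q.
rewrite -(clsM s t) -(clsZ a t) -(clsZ a (s * t)%A) -(clsM s (a *: t)%A).
exact/clsP/acong_scaleAr.
Qed.

(* Substitution of generators; it descends to an algebra endomorphism of the
   quotient as soon as it respects the relations. *)
Fixpoint amap (f : gen -> gen) (s : term) : term :=
  match s with
  | Agen g => Agen (f g)
  | Azero => 0
  | Aone => 1
  | Aadd s t => amap f s + amap f t
  | Ascale a s => a *: amap f s
  | Amul s t => amap f s * amap f t
  end%A.

Definition pmap (f : gen -> gen) (p : presented) : presented :=
  cls (amap f (generic_quotient.repr p)).

Lemma acong_amap f : (forall s t, rel s t -> cls (amap f s) = cls (amap f t)) ->
  forall s t, acong s t -> acong (amap f s) (amap f t).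
Proof.
move=> frel s t; elim=> {s t} /=; try by constructor.
- by move=> s t /frel/clsP.
- by move=> s t u _ st _ tu; apply: acong_trans st tu.
Qed.

Section PmapTheory.
Variable f : gen -> gen.
Hypothesis frel : forall s t, rel s t -> cls (amap f s) = cls (amap f t).

Lemma pmap_cls s : pmap f (cls s) = cls (amap f s).
Proof. by apply/clsP; apply: acong_amap => //; apply: cls_repr. Qed.

Lemma pmap_linear a p q : pmap f (a *: p + q) = a *: pmap f p + pmap f q.
Proof.
by rewrite -[p]clsK -[q]clsK -clsZ -clsD !pmap_cls /= clsD clsZ.
Qed.
Lemma pmapM p q : pmap f (p * q) = pmap f p * pmap f q.
Proof. by rewrite -[p]clsK -[q]clsK -clsM !pmap_cls /= clsM. Qed.
Lemma pmap1 : pmap f 1 = 1.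
Proof. by rewrite -cls1 pmap_cls. Qed.
End PmapTheory.

End Presented.

(* The structure carried by the rational cohomology algebra of a connected
   smooth complex projective variety of complex dimension m, with coh k = H^k:
   a graded-commutative Poincare duality algebra of formal dimension 2m. Hodge
   structures and Lefschetz properties are not recorded. *)
Record cohomology (m : nat) := Cohomology {
  coh_alg :> falgType rat;
  coh : nat -> {vspace coh_alg};
  coh_sum : (\sum_(k < m.*2.+1) coh k)%VS = fullv;
  coh_direct : directv (\sum_(k < m.*2.+1) coh k)%VS;
  coh_vanish : forall k, (m.*2 < k)%N -> coh k = 0%VS;
  coh_connected : coh 0 = <[1]>%VS;
  coh_prod : forall i j, (coh i * coh j <= coh (i + j))%VS;
  coh_gcomm : forall i j x y, x \in coh i -> y \in coh j ->
    x * y = (-1) ^+ (i * j) * (y * x);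
  fundamental : coh_alg;
  fundamental_neq0 : fundamental != 0;
  coh_top : coh m.*2 = <[fundamental]>%VS;
  coh_poincare : forall k x, (k <= m.*2)%N -> x \in coh k -> x != 0 ->
    exists2 y, y \in coh (m.*2 - k) & x * y = fundamental
}.

(* Indices start at 0: basis element number 0 is x_1 = 1 and the last one is
   the fundamental class; the order on the basis is the order of the indices. *)
Record ordered_basis (m : nat) (X : cohomology m) (B : nat) := OrderedBasis {
  bas :> 'I_B -> X;
  bas_deg : 'I_B -> nat;
  bas_basis : basis_of fullv [seq bas i | i <- enum 'I_B];
  bas_homog : forall i, bas i \in coh X (bas_deg i);
  bas_deg_mono : forall i j : 'I_B, (i <= j)%N -> (bas_deg i <= bas_deg j)%N;
  bas_first : forall i : 'I_B, i = 0 :> nat -> bas i = 1;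
  bas_last : forall i : 'I_B, i.+1 = B -> bas i = fundamental X
}.

Inductive kgen (H : Type) (n : nat) : Type :=
| Kp of 'I_n & H
| KG of 'I_n & 'I_n.

Arguments Kp {H n} _ _.
Arguments KG {H n} _ _.

Section Kriz.

Variables (m : nat) (X : cohomology m) (n : nat).
Local Notation kterm := (aterm rat (kgen X n)).

Definition tp (i : 'I_n) (x : X) : kterm := Agen (Kp i x).
Definition tG (i j : 'I_n) : kterm := Agen (KG i j).

Definition kgen_deg (g : kgen X n) (k : nat) : Prop :=
  match g with
  | Kp _ x => x \in coh X k
  | KG _ _ => k = m.*2.-1
  end.

(* krel_lin, krel_one and krel_mul, with graded commutativity of the symbols
   tp, present H^*(X)^{(x)n} = H^*(X^n), where tp i x stands for p_i^*(x).
   Graded commutativity of the odd symbols tG gives (tG i j)^2 = 0 over the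
   rationals, i.e. the exterior algebra. The symbol tG i i is a dummy. *)
Inductive krel : kterm -> kterm -> Prop :=
| krel_lin i (a : rat) (x y : X) :
    krel (tp i (a *: x + y)%R) (a *: tp i x + tp i y)%A
| krel_one i : krel (tp i 1%R) 1%A
| krel_mul i (x y : X) : krel (tp i (x * y)%R) (tp i x * tp i y)%A
| krel_gcomm g h k l : kgen_deg g k -> kgen_deg h l ->
    krel (Agen g * Agen h)%A (((-1) ^+ (k * l))%R *: (Agen h * Agen g))%A
| krel_Gdiag i : krel (tG i i) 0%A
| krel_Gsym i j : krel (tG j i) (tG i j)
| krel_pG (i j : 'I_n) (x : X) : (i < j)%N -> krel (tp j x * tG i j)%A (tp i x * tG i j)%A
| krel_arnold (i j k : 'I_n) : (i < j < k)%N ->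
    krel (tG i k * tG j k)%A
         (tG i j * tG j k + (- (1 : rat))%R *: (tG i j * tG i k))%A.

Definition kriz := presented krel.
HB.instance Definition _ := GRing.PzRing.on kriz.
HB.instance Definition _ := GRing.Lmodule.on kriz.

Definition kp (i : 'I_n) (x : X) : kriz := cls krel (tp i x).
Definition kG (i j : 'I_n) : kriz := cls krel (tG i j).

Lemma kp_lin i a x y : kp i (a *: x + y) = a *: kp i x + kp i y.
Proof. by rewrite /kp -clsZ -clsD; apply/clsP/acong_rel/krel_lin. Qed.
Lemma kp1 i : kp i 1 = 1.
Proof. by rewrite /kp -cls1; apply/clsP/acong_rel/krel_one. Qed.
Lemma kpM i x y : kp i (x * y) = kp i x * kp i y.
Proof. by rewrite /kp -clsM; apply/clsP/acong_rel/krel_mul. Qed.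
Lemma kgen_gcomm g h k l : kgen_deg g k -> kgen_deg h l ->
  cls krel (Agen g) * cls krel (Agen h) =
  (-1) ^+ (k * l) *: (cls krel (Agen h) * cls krel (Agen g)) :> kriz.
Proof.
by move=> gk hl; rewrite -!clsM -clsZ; apply/clsP/acong_rel/krel_gcomm.
Qed.
Lemma kG_diag i : kG i i = 0.
Proof. by rewrite /kG -cls0; apply/clsP/acong_rel/krel_Gdiag. Qed.
Lemma kG_sym i j : kG j i = kG i j.
Proof. exact/clsP/acong_rel/krel_Gsym. Qed.
Lemma kG_pG i j x : kp j x * kG i j = kp i x * kG i j.
Proof.
have [lt_ij | lt_ji | /ord_inj ->] := ltngtP i j; last by [].
  by rewrite /kp /kG -!clsM; apply/clsP/acong_rel/krel_pG.
rewrite -(kG_sym i j) /kp /kG -!clsM.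
exact/clsP/acong_sym/acong_rel/krel_pG.
Qed.

Lemma kG_anti i j k l : (0 < m)%N -> kG i j * kG k l = - (kG k l * kG i j).
Proof.
move=> m_gt0; have odd_deg : odd m.*2.-1.
  by rewrite -(prednK m_gt0) doubleS /= odd_double.
have := @kgen_gcomm (KG i j) (KG k l) m.*2.-1 m.*2.-1 erefl erefl.
by rewrite -signr_odd oddM odd_deg expr1 scaleN1r.
Qed.

Definition arnold i j k :=
  kG i j * kG j k + kG j k * kG k i + kG k i * kG i j = 0.

Lemma arnold_rot i j k : arnold i j k -> arnold j k i.
Proof. by rewrite /arnold => <-; rewrite -[RHS]addrA [RHS]addrC. Qed.

Lemma arnold_swap i j k : (0 < m)%N -> arnold i j k -> arnold j i k.
Proof.
rewrite /arnold => m_gt0 ijk.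
rewrite (kG_sym i j) (kG_sym k i) (kG_sym j k).
rewrite (kG_anti i j k i m_gt0) (kG_anti k i j k m_gt0) (kG_anti j k i j m_gt0).
by rewrite -!opprD addrC [X in _ + X]addrC addrA ijk oppr0.
Qed.

Lemma arnoldP i j k : (0 < m)%N -> i != j -> j != k -> i != k -> arnold i j k.
Proof.
move=> m_gt0; have lt_arnold (a b c : 'I_n) : (a < b < c)%N -> arnold a b c.
  move=> abc; rewrite /arnold (kG_sym a c) (kG_anti b c a c m_gt0).
  have -> : kG a c * kG b c = kG a b * kG b c - kG a b * kG a c.
    rewrite -scaleN1r /kG -!clsM -clsZ -clsD.
    by apply/clsP/acong_rel/krel_arnold.
  by rewrite (kG_anti a c a b m_gt0) opprB addrCA subrr addr0 subrr.
have swap := fun a b c => @arnold_swap a b c m_gt0; have rot := arnold_rot.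
rewrite -!val_eqE /= !neq_ltn.
case: (ltngtP i j) => //= ij _; case: (ltngtP j k) => //= jk _;
  case: (ltngtP i k) => //= ik _; try by [].
- by apply: lt_arnold; rewrite ij.
- by have := ltn_trans ij jk; rewrite ltnNge ltnW.
- by apply: rot; apply: swap; apply: lt_arnold; rewrite ik.
- by apply: rot; apply: lt_arnold; rewrite ik.
- by apply: swap; apply: lt_arnold; rewrite ij.
- by apply: (@arnold_rot k i j); apply: (@arnold_rot j k i); apply: lt_arnold; rewrite jk.
- by have := ltn_trans jk ij; rewrite ltnNge ltnW.
- by apply: swap; apply: rot; apply: lt_arnold; rewrite jk.
Qed.

Lemma kG_arnold i j k : (0 < m)%N -> i != j -> j != k -> i != k ->
  kG i k * kG j k = kG i j * kG j k - kG i j * kG i k.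
Proof.
move=> m_gt0 ij jk ik; have := arnoldP m_gt0 ij jk ik; rewrite /arnold.
rewrite (kG_sym i k) (kG_anti j k i k m_gt0) (kG_anti i k i j m_gt0).
by rewrite addrAC => /eqP; rewrite subr_eq0 => /eqP.
Qed.

(* Permutations of mathcomp compose from left to right, (s * t) i = t (s i),
   so this is an action of 'S_n on the right: kact (s * t) = kact t \o kact s.
   It is the left action s (p_i^*(x)) = p_{s i}^*(x), s (G_ij) = G_{s i, s j}
   for the usual composition of permutations. *)
Definition kren (s : 'S_n) (g : kgen X n) : kgen X n :=
  match g with
  | Kp i x => Kp (s i) x
  | KG i j => KG (s i) (s j)
  end.

Definition kact (s : 'S_n) : kriz -> kriz := @pmap rat _ krel (kren s).

Lemma kren_rel s : (0 < m)%N ->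
  forall t u, krel t u -> cls krel (amap (kren s) t) = cls krel (amap (kren s) u).
Proof.
move=> m_gt0 t u; case=> {t u} /=.
- by move=> i a x y; apply/clsP/acong_rel/krel_lin.
- by move=> i; apply/clsP/acong_rel/krel_one.
- by move=> i x y; apply/clsP/acong_rel/krel_mul.
- move=> g h k l gk hl; apply/clsP/acong_rel/krel_gcomm.
    by case: g gk.
  by case: h hl.
- by move=> i; apply/clsP/acong_rel/krel_Gdiag.
- by move=> i j; apply/clsP/acong_rel/krel_Gsym.
- by move=> i j x _; rewrite !clsM; apply: kG_pG.
- move=> i j k /andP[ij jk]; rewrite clsD clsZ !clsM scaleN1r.
  apply: kG_arnold => //; rewrite (inj_eq perm_inj) -val_eqE neq_ltn ?ij ?jk //.
  by rewrite (ltn_trans ij jk).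
Qed.

Section KactTheory.
Variable s : 'S_n.
Hypothesis m_gt0 : (0 < m)%N.
Lemma kact_p i x : kact s (kp i x) = kp (s i) x.
Proof. exact: pmap_cls (kren_rel s m_gt0) _. Qed.
Lemma kact_G i j : kact s (kG i j) = kG (s i) (s j).
Proof. exact: pmap_cls (kren_rel s m_gt0) _. Qed.
Lemma kact_linear a u v : kact s (a *: u + v) = a *: kact s u + kact s v.
Proof. exact: pmap_linear (kren_rel s m_gt0) _ _ _. Qed.
Lemma kactM u v : kact s (u * v) = kact s u * kact s v.
Proof. exact: pmapM (kren_rel s m_gt0) _ _. Qed.
Lemma kact1 : kact s 1 = 1.
Proof. exact: pmap1 (kren_rel s m_gt0). Qed.
End KactTheory.

End Kriz.

Definition lin_span (F : pzRingType) (V : lmodType F) (I : finType) (P : pred I)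
    (f : I -> V) (v : V) : Prop :=
  exists c : I -> F, v = \sum_(i | P i) c i *: f i.

Section Strand.

Variables (m : nat) (X : cohomology m) (B : nat) (x : ordered_basis X B).
Variable n : nat.

Definition kmono (a : {ffun 'I_n -> 'I_B}) : kriz X n :=
  \prod_(k < n) kp k (x (a k)).

(* E_q^k(X, n) *)
Definition kriz_part (q k : nat) : kriz X n -> Prop :=
  lin_span
    (fun u : {ffun 'I_n -> 'I_B} * q.-tuple ('I_n * 'I_n) =>
       \sum_i bas_deg x (u.1 i) + q * m.*2.-1 == k)%N
    (fun u => kmono u.1 * \prod_(e <- u.2) kG X e.1 e.2).

(* H = (h_1; h_2^(m_2), ..., h_t^(m_t)) is given by h1 and by the sequence hs
   of the pairs (h_l, m_l), 2 <= l <= t; its weight is |H|. *)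
Definition weight (h1 : 'I_B) (hs : seq ('I_B * nat)) : nat :=
  bas_deg x h1 + \sum_(u <- hs) u.2 * bas_deg x u.1.

Definition of_type (h1 : 'I_B) (hs : seq ('I_B * nat))
    (a : {ffun 'I_n -> 'I_B}) (i j : 'I_n) : bool :=
  [&& (i < j)%N, x (a i) == x h1, x (a j) == 1 &
      all (fun u => #|[set k | [&& k != i, k != j & x (a k) == x u.1]]| == u.2) hs].

(* E_1^{2m-1+weight}(L, H) for L = (2, 1^(n-2)) and H given by h1 and hs *)
Definition strand (h1 : 'I_B) (hs : seq ('I_B * nat)) : kriz X n -> Prop :=
  lin_span
    (fun u : {ffun 'I_n -> 'I_B} * ('I_n * 'I_n) => of_type h1 hs u.1 u.2.1 u.2.2)
    (fun u => kmono u.1 * kG X u.2.1 u.2.2).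

End Strand.

Lemma bas_inj m (X : cohomology m) B (x : ordered_basis X B) : injective x.
Proof.
apply/injectiveP; rewrite /injectiveb /dinjectiveb.
exact: free_uniq (basis_free (bas_basis x)).
Qed.

Lemma coh_deg_inj m (X : cohomology m) k l (y : X) :
  y != 0 -> y \in coh X k -> y \in coh X l -> k = l.
Proof.
move=> y0 yk yl; apply/eqP; apply: contraNT y0 => kl.
have [kt|kt] := ltnP m.*2 k; first by move: yk; rewrite coh_vanish // memv0.
have [lt|lt] := ltnP m.*2 l; first by move: yl; rewrite coh_vanish // memv0.
pose k' := @Ordinal m.*2.+1 k kt; pose l' := @Ordinal m.*2.+1 l lt.
have /directv_sum_independent := coh_direct X.
move/(_ (fun i => if i == k' then y else if i == l' then - y else 0)).
have l'k' : l' != k' by rewrite eq_sym -val_eqE.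
move=> /(_ _ _ k' isT); rewrite eqxx => ->//.
  move=> i _; case: eqP => [->//|_]; case: eqP => [->|_]; first by rewrite memvN.
  exact: mem0v.
rewrite (bigD1 k') //= eqxx (bigD1 l') //= (negPf l'k') eqxx big1 ?addr0 ?subrr //.
by move=> i /andP[/negPf-> /negPf->].
Qed.

Lemma bas_deg1 m (X : cohomology m) B (x : ordered_basis X B) i :
  x i = 1 -> bas_deg x i = 0%N.
Proof.
move=> xi; apply: (@coh_deg_inj _ X _ _ (1 : X)); first exact: oner_neq0.
  by rewrite -xi bas_homog.
by rewrite coh_connected memv_line.
Qed.

Lemma lin_span_sub (F : pzRingType) (V : lmodType F) (I J : finType) (P : pred I)
    (Q : pred J) (f : I -> V) (g : J -> V) (h : I -> J) :
  (forall u, P u -> Q (h u)) -> (forall u, P u -> g (h u) = f u) ->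
  forall v, lin_span P f v -> lin_span Q g v.
Proof.
move=> PQ gf v [c ->]; exists (fun w => \sum_(u | P u && (h u == w)) c u).
under [RHS]eq_bigr do rewrite scaler_suml.
rewrite (exchange_big_dep P) /=; last by move=> w u _ /andP[].
apply: eq_bigr => u Pu; rewrite (big_pred1 (h u)) ?gf // => w /=.
by rewrite Pu eq_sym andb_idl // => /eqP ->; apply: PQ.
Qed.

Lemma of_type_deg m (X : cohomology m) B (x : ordered_basis X B) n h1 hs
    (a : {ffun 'I_n -> 'I_B}) i j :
  sorted (fun u v : 'I_B * nat => (v.1 < u.1)%N) hs ->
  (2 + sumn (unzip2 hs))%N = n -> of_type x h1 hs a i j ->
  (\sum_k bas_deg x (a k))%N = weight x h1 hs.
Proof.
move=> hs_sorted hs_sum /and4P[lt_ij /eqP/bas_inj ai /eqP/bas_deg1 aj hs_type].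
have ij : j != i by rewrite eq_sym neq_ltn lt_ij.
have uniq_hs : uniq (unzip1 hs).
  have: sorted (fun u v : 'I_B => (v < u)%N) (unzip1 hs) by rewrite sorted_map.
  apply: sorted_uniq => [u v w vu wv|u]; last exact: ltnn.
  exact: ltn_trans wv vu.
pose R := [set k | (k != i) && (k != j)].
pose S (u : 'I_B * nat) := [set k | [&& k != i, k != j & a k == u.1]].
have cardS u : u \in hs -> #|S u| = u.2.
  move=> /(allP hs_type)/eqP <-; apply: eq_card => k.
  by rewrite !inE (inj_eq (@bas_inj _ _ _ x)).
have cardR : #|R| = sumn (unzip2 hs).
  have -> : R = ~: [set i; j] by apply/setP=> k; rewrite !inE negb_or.
  apply/eqP; rewrite -(eqn_add2l #|[set i; j]|) cardsC card_ord cards2.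
  by rewrite (eq_sym i) ij -hs_sum.
pose N h := #|[set k in R | a k == h]|.
have N_hs u : u \in hs -> N u.1 = u.2.
  by move=> hu; rewrite -(cardS u hu); apply: eq_card => k; rewrite !inE andbA.
have sumR (G : 'I_B -> nat) :
    (\sum_(k in R) G (a k) = \sum_(h in unzip1 hs) N h * G h +
                             \sum_(h | h \notin unzip1 hs) N h * G h)%N.
  rewrite (partition_big a predT) //= (bigID (mem (unzip1 hs))) /=.
  by congr addn; apply: eq_bigr => h _; rewrite -sum_nat_const;
     apply: eq_big => [k | k /andP[_ /eqP->]]; rewrite ?inE.
have sum_hs (G : 'I_B -> nat) :
    (\sum_(h in unzip1 hs) N h * G h = \sum_(u <- hs) u.2 * G u.1)%N.
  rewrite -big_uniq // big_map big_seq [RHS]big_seq.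
  by apply: eq_bigr => u /N_hs ->.
have N0 h : h \notin unzip1 hs -> N h = 0%N.
  move=> hN; have := sumR (fun=> 1%N); rewrite sum1_card cardR sum_hs.
  rewrite sumnE big_map.
  rewrite -[X in (_ = X + _)%N](eq_bigr _ (fun u _ => esym (muln1 u.2))).
  move/eqP; rewrite -[X in X == _]addn0 eqn_add2l eq_sym sum_nat_eq0.
  by move=> /forallP/(_ h); rewrite hN /= muln1 => /eqP.
rewrite (bigD1 i) //= (bigD1 j) //= aj add0n /weight ai; congr addn.
rewrite -(sum_hs (bas_deg x)) -[RHS]addn0.
transitivity (\sum_(k in R) bas_deg x (a k))%N.
  by apply: eq_bigl => k; rewrite inE.
by rewrite sumR; congr addn; apply: big1 => h /N0 ->.
Qed.

(* The superscript in E_1^{2m-1+weight} is the total degree. *)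
Lemma strand_part m (X : cohomology m) B (x : ordered_basis X B) n h1 hs v :
  sorted (fun u v : 'I_B * nat => (v.1 < u.1)%N) hs ->
  (2 + sumn (unzip2 hs))%N = n ->
  strand x h1 hs v -> kriz_part x (n := n) 1 (m.*2.-1 + weight x h1 hs) v.
Proof.
move=> hs_sorted hs_sum.
apply: (lin_span_sub (h := fun u : {ffun 'I_n -> 'I_B} * ('I_n * 'I_n) =>
  (u.1, [tuple u.2]))) => [u /(of_type_deg hs_sorted hs_sum) /= -> | u _ /=].
  by rewrite mul1n addnC.
by rewrite big_seq1.
Qed.

Section Induced.

Variables (F : fieldType) (gT : finGroupType) (H : {group gT}).
Variables (d : nat) (rH : mx_representation F H d).

Local Notation k := #|rcosets H [set: gT]|.

Definition coset_rep (i : 'I_k) : gT := fingroup.repr (enum_val i).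

(* With r_i the representatives of the right cosets of H, the induced module
   rH (x)_{F[H]} F[gT] is the direct sum of the rH (x) r_i, and
   (v (x) r_i) g = v (rH (r_i g r_j^-1)) (x) r_j if H r_i g = H r_j. *)
Definition ind_mx (g : gT) : 'M[F]_(\sum_(i < k) d) :=
  \mxblock_(i < k, j < k)
    (if (coset_rep i * g * (coset_rep j)^-1)%g \in H
     then rH (coset_rep i * g * (coset_rep j)^-1)%g else 0).

Lemma coset_repP (g : gT) (i : 'I_k) : exists j : 'I_k,
  forall j', ((coset_rep i * g * (coset_rep j')^-1)%g \in H) = (j' == j).
Proof.
have repE (l : 'I_k) : enum_val l = (H :* coset_rep l)%g.
  have /rcosetsP[y _ ly] := enum_valP l.
  by rewrite /coset_rep ly rcoset_repr.
have Hg : (H :* (coset_rep i * g))%g \in rcosets H [set: gT].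
  by apply/rcosetsP; exists (coset_rep i * g)%g.
exists (enum_rank_in Hg (H :* (coset_rep i * g))%g) => j'.
rewrite -mem_rcoset -[j' == _](inj_eq enum_val_inj) enum_rankK_in // repE.
by apply/idP/eqP => [/rcoset_eqP -> | ->] //; apply: rcoset_refl.
Qed.

Lemma ind_mx_repr : mx_repr [set: gT] ind_mx.
Proof.
split=> [|g h _ _].
  rewrite /ind_mx -(mxdiagZ (1 : F)) /mxdiag; apply/eq_mxblock => i j.
  have [l Hl] := coset_repP 1 i.
  have il : i == l by rewrite -Hl mulg1 mulgV group1.
  rewrite Hl -(eqP il); case: (altP (j =P i)) => [-> | /negPf ji].
    by rewrite eqxx mulg1 mulgV repr_mx1 conform_mx_id.
  by rewrite eq_sym ji.
rewrite /ind_mx mul_mxblock; apply/eq_mxblock => i j.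
have [l Hl] := coset_repP g i.
rewrite (bigD1 l) //= [X in _ = _ + X]big1 => [|l' /negPf l'l]; last first.
  by rewrite Hl l'l mul0mx.
have HA : (coset_rep i * g * (coset_rep l)^-1)%g \in H by rewrite Hl.
have -> : (coset_rep i * (g * h) * (coset_rep j)^-1 =
    coset_rep i * g * (coset_rep l)^-1 * (coset_rep l * h * (coset_rep j)^-1))%g.
  by rewrite !mulgA mulgKV.
rewrite HA groupMl // addr0; case: ifP => HB; last by rewrite mulmx0.
by rewrite repr_mxM.
Qed.

Definition ind_repr := MxRepresentation ind_mx_repr.

End Induced.

Section YoungModules.

Variables (F : fieldType) (n : nat).

Lemma triv_mx_repr (gT : finGroupType) (G : {group gT}) :
  mx_repr G (fun _ : gT => 1%:M : 'M[F]_1).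
Proof. by split=> // g h _ _; rewrite mulmx1. Qed.

Lemma sign_mx_repr (G : {group 'S_n}) :
  mx_repr G (fun s : 'S_n => ((-1) ^+ s)%:M : 'M[F]_1).
Proof.
split=> [|s t _ _]; first by rewrite odd_perm1.
by rewrite odd_permM signr_addb scalar_mxM.
Qed.

(* V(r) and V(1^r) for the group of permutations of a set of r points *)
Definition triv_repr (B : {set 'I_n}) : mx_representation F (perm.Sym B) 1 :=
  MxRepresentation (triv_mx_repr _).
Definition sign_repr (B : {set 'I_n}) : mx_representation F (perm.Sym B) 1 :=
  MxRepresentation (sign_mx_repr _).

Variable c : seq nat.

(* The l-th block of consecutive integers for the composition c of n, and the
   standard Young subgroup: the internal direct product of the Sym (block l),
   with projections restr_perm (block l). *)
Definition block (l : nat) : {set 'I_n} :=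
  [set i : 'I_n | sumn (take l c) <= i < sumn (take l.+1 c)]%N.

Definition young : {group 'S_n} :=
  (\bigcap_(l < size c) 'N(block l | 'P))%G.

Lemma young_restr l :
  (young \subset restr_perm_morphism (block l) @*^-1 (perm.Sym (block l)))%g.
Proof.
have nYl : (young \subset 'N(block l | 'P))%g.
  have [lt_l | ge_l] := ltnP l (size c); first exact: (bigcap_inf (Ordinal lt_l)).
  have -> : block l = set0.
    apply/setP=> i; rewrite !inE !take_oversize ?(leqW ge_l) //.
    by apply/andP=> -[le_i]; rewrite ltnNge le_i.
  by apply/subsetP=> s _; rewrite !inE; apply/subsetP=> i; rewrite inE.
apply/subsetP=> s Ys; rewrite mem_morphpre ?(subsetP nYl) // inE.
exact: restr_perm_on.
Qed.

(* Pullback along the projection young -> Sym (block l) *)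
Definition factor_repr l d (rB : mx_representation F (perm.Sym (block l)) d) :
    representation F young :=
  Representation (subg_repr (morphpre_repr _ rB) (young_restr l)).

Definition tensor_repr (rV rW : representation F young) : representation F young :=
  Representation (prod_repr rV rW).

End YoungModules.

(* V^{epsilon(r, h)} over the symmetric group of a set of r points *)
Definition eps_repr (m : nat) (X : cohomology m) (Bn : nat)
    (x : ordered_basis X Bn) (n : nat) (B : {set 'I_n}) (r : nat) (h : 'I_Bn) :
    mx_representation rat (perm.Sym B) 1 :=
  if (r == 1) || ~~ odd (bas_deg x h) then triv_repr rat B else sign_repr rat B.

Section InducingModule.

Variables (m : nat) (X : cohomology m) (B : nat) (x : ordered_basis X B).
Variables (n : nat) (hs : seq ('I_B * nat)).

Definition composition : seq nat := 2 :: unzip2 hs.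

(* V(2) (x) V^{epsilon(m_2, h_2)} (x) ... (x) V^{epsilon(m_t, h_t)} *)
Definition young_module : representation rat (young n composition) :=
  foldl (@tensor_repr rat n composition)
    (factor_repr (triv_repr rat (block n composition 0)))
    [seq factor_repr (eps_repr x (block n composition l.+1)
                        (tnth (in_tuple hs) l).2 (tnth (in_tuple hs) l).1)
    | l : 'I_(size hs) <- enum 'I_(size hs)].

End InducingModule.

(* The submodule U of V, a module for the right action act of gT, is stable
   and isomorphic to the module of row vectors under rG. *)
Definition submodule_iso (F : fieldType) (gT : finGroupType) (V : lmodType F)
    (act : gT -> V -> V) (U : V -> Prop) (d : nat)
    (rG : mx_representation F [set: gT] d) : Prop :=
  exists phi : {linear 'rV[F]_d -> V},
    [/\ injective phi,
        forall v, U v <-> exists u, v = phi u &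
        forall g u, phi (u *m rG g) = act g (phi u)].

(* Main.v *)
(* An element of the strand is moved around by S_n up to sign: reordering the
   odd classes of a monomial costs signs, and a class at j next to G_ij may be
   moved to i. Hence the monomial e0 whose classes are constant on the
   consecutive blocks of the composition spans a line stable under the Young
   subgroup. A transposition inside a block acts on this line by -1 if the class
   of the block is odd and by 1 otherwise, because the middle factors are crossed
   twice; on the first block, {i, j}, it acts by 1 because p_j^*(x) G_ij =
   p_i^*(x) G_ij. The translates of e0 by coset representatives are, up to sign,
   exactly the monomials of the strand, so it remains to show that these are
   linearly independent in the presented algebra. For each pair i < j the algebra
   acts on the graded tensor product of n copies of H^*(X) and an exterior
   algebra on one generator, p_j acting through the i-th factor and every G other
   than G_ij by 0; the Arnold relation holds as every product of two G's acts by
   0. Applied to the vacuum vector, the monomials with factor G_ij give distinct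
   basis vectors. *)
From HB Require Import structures.
Require Import Defs.
From mathcomp Require Import all_boot all_order all_algebra.
From mathcomp Require Import all_fingroup all_solvable all_field all_character.
From mathcomp Require Import ring.

Set Implicit Arguments.
Unset Strict Implicit.
Unset Printing Implicit Defensive.

Import GRing.Theory.
Local Open Scope ring_scope.

(** * Operators on a module that satisfy the relations of a presented algebra *)

Section Evaluation.

Variables (F : fieldType) (gen : Type).
Variable rel : aterm F gen -> aterm F gen -> Prop.
Variables (V : lmodType F) (op : gen -> V -> V).
Hypothesis op_linear : forall g a u v, op g (a *: u + v) = a *: op g u + op g v.

Fixpoint aeval (s : aterm F gen) (v : V) : V :=
  match s with
  | Agen g => op g v
  | Azero => 0
  | Aone => v
  | Aadd s t => aeval s v + aeval t v
  | Ascale a s => a *: aeval s v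
  | Amul s t => aeval s (aeval t v)
  end.

Lemma aeval_linear s a u v : aeval s (a *: u + v) = a *: aeval s u + aeval s v.
Proof.
elim: s a u v => [g|||s IHs t IHt|b s IHs|s IHs t IHt] a u v //=.
- by rewrite scaler0 addr0.
- by rewrite IHs IHt scalerDr addrACA.
- by rewrite IHs scalerDr !scalerA mulrC.
- by rewrite IHt IHs.
Qed.

Lemma aevalD s u v : aeval s (u + v) = aeval s u + aeval s v.
Proof. by rewrite -[u in LHS]scale1r aeval_linear scale1r. Qed.

Lemma aeval0 s : aeval s 0 = 0.
Proof.
by rewrite -[X in aeval s X](addNr 0) -scaleN1r aeval_linear scaleN1r addNr.
Qed.

Lemma aevalZ s a u : aeval s (a *: u) = a *: aeval s u.
Proof. by rewrite -[a *: u]addr0 aeval_linear aeval0 addr0. Qed.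

Hypothesis op_rel : forall s t, rel s t -> aeval s =1 aeval t.

(** Composition of linear operators obeys every algebra axiom, with linearity entering in
    distributivity and scaling on the right factor. Hence only the defining relations, [op_rel],
    remain to be checked for a module structure. *)
Lemma acong_aeval s t : acong rel s t -> aeval s =1 aeval t.
Proof.
elim=> {s t} /=.
- exact: op_rel.
- by [].
- by move=> s t _ IH v; rewrite IH.
- by move=> s t u _ IH1 _ IH2 v; rewrite IH1.
- by move=> s s' t t' _ IH1 _ IH2 v /=; rewrite IH1 IH2.
- by move=> a s s' _ IH v /=; rewrite IH.
- by move=> s s' t t' _ IH1 _ IH2 v /=; rewrite IH1 IH2.
- by move=> s t u v /=; rewrite addrA.
- by move=> s t v /=; rewrite addrC.
- by move=> s v /=; rewrite add0r.
- by move=> s v /=; rewrite scaleN1r addNr.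
- by move=> a b s v /=; rewrite scalerA.
- by move=> s v /=; rewrite scale1r.
- by move=> a s t v /=; rewrite scalerDr.
- by move=> a b s v /=; rewrite scalerDl.
- by [].
- by [].
- by [].
- by [].
- by move=> s t u v /=; rewrite aevalD.
- by [].
- by move=> a s t v /=; rewrite aevalZ.
Qed.

Definition peval (p : presented rel) (v : V) : V :=
  aeval (generic_quotient.repr p) v.

Lemma peval_cls s v : peval (cls rel s) v = aeval s v.
Proof. exact/acong_aeval/cls_repr. Qed.

Lemma peval1 v : peval 1 v = v.
Proof. by rewrite -cls1 peval_cls. Qed.

Lemma pevalM p q v : peval (p * q) v = peval p (peval q v).
Proof. by rewrite -[p]clsK -[q]clsK -clsM !peval_cls. Qed.

Lemma pevalD p q v : peval (p + q) v = peval p v + peval q v.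
Proof. by rewrite -[p]clsK -[q]clsK -clsD !peval_cls. Qed.

Lemma pevalZ a p v : peval (a *: p) v = a *: peval p v.
Proof. by rewrite -[p]clsK -clsZ !peval_cls. Qed.

Lemma peval_op0 p : peval p 0 = 0.
Proof. exact: aeval0. Qed.

End Evaluation.

(** * Structure constants of the cohomology algebra in a homogeneous basis *)

Section StructureConstants.

Variables (m : nat) (X : cohomology m) (B : nat) (x : ordered_basis X B).
Local Notation deg := (bas_deg x).

Definition bas_tuple : B.-tuple X := [tuple x b | b < B].

Lemma bas_tupleE (b : 'I_B) : bas_tuple`_b = x b.
Proof. by rewrite -(tnth_nth 0 bas_tuple b) tnth_mktuple. Qed.

Lemma bas_tuple_basis : basis_of fullv bas_tuple.
Proof. exact: bas_basis. Qed.

Lemma coord_bas (b c : 'I_B) : coord bas_tuple c (x b) = (c == b)%:R.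
Proof.
by rewrite -bas_tupleE coord_free ?(basis_free bas_tuple_basis) // eq_sym.
Qed.

Lemma bas_expand y : y = \sum_b coord bas_tuple b y *: x b.
Proof.
rewrite {1}(coord_basis bas_tuple_basis (memvf y)).
by apply: eq_bigr => b _; rewrite bas_tupleE.
Qed.

(** The difference of [y] and its degree [d] part [z] lies both in [coh X d] and in the sum of the
    other graded pieces, so it vanishes because the sum is direct. *)
Lemma coord_homog d y c : y \in coh X d -> coord bas_tuple c y != 0 -> deg c = d.
Proof.
move=> yd; have [lt_d|le_d] := ltnP m.*2 d.
  by move: yd; rewrite coh_vanish // memv0 => /eqP->; rewrite linear0 eqxx.
pose z := \sum_(b | deg b == d) coord bas_tuple b y *: x b.
have zd : z \in coh X d.
  by apply: memv_suml => b /eqP <-; rewrite memvZ // bas_homog.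
suff ->: y = z.
  rewrite linear_sum /=; apply: contraNeq => dc.
  apply/eqP; rewrite big1 // => b /eqP db; rewrite linearZ /= coord_bas.
  by case: eqP => [cb|]; [case/eqP: dc; rewrite cb | rewrite mulr0].
apply/eqP; rewrite -subr_eq0 -memv0.
have /directv_sumP/(_ (Ordinal (le_d : (d < m.*2.+1)%N)) isT) <- := coh_direct X.
rewrite memv_cap rpredB //= {1}[y]bas_expand (bigID (fun b => deg b == d)) /=.
rewrite addrC addrK; apply: memv_suml => b db; apply: memvZ.
have [lt_b|le_b] := ltnP m.*2 (deg b).
  by have := bas_homog x b; rewrite coh_vanish // memv0 => /eqP->; rewrite mem0v.
have := bas_homog x b; apply: subvP.
exact: (sumv_sup (Ordinal (le_b : (deg b < m.*2.+1)%N))).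
Qed.

Definition lmul_coef (y : X) (b c : 'I_B) : rat := coord bas_tuple c (y * x b).

(** This turns the exponents of [mul_op], which are written in degrees of basis elements, into
    Koszul signs for [y]. *)
Lemma lmul_coef_homog d y b c :
  y \in coh X d -> lmul_coef y b c != 0 -> deg c = (d + deg b)%N.
Proof.
move=> yd; apply: coord_homog; apply: (subvP (coh_prod _ _ _)).
by rewrite memv_mul // bas_homog.
Qed.

Lemma lmul_coef1 b c : lmul_coef 1 b c = (c == b)%:R.
Proof. by rewrite /lmul_coef mul1r coord_bas. Qed.

Lemma lmul_coefM y z b c :
  lmul_coef (y * z) b c = \sum_d lmul_coef y d c * lmul_coef z b d.
Proof.
rewrite /lmul_coef -mulrA [in LHS](bas_expand (z * x b)) mulr_sumr linear_sum /=.
by apply: eq_bigr => d _; rewrite -scalerAr linearZ /= mulrC.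
Qed.

Lemma lmul_coef_linear a y z b c :
  lmul_coef (a *: y + z) b c = a * lmul_coef y b c + lmul_coef z b c.
Proof. by rewrite /lmul_coef mulrDl -scalerAl linearP. Qed.

End StructureConstants.

(** * The action of the Kriz model attached to one pair of indices *)

Section Model.

Variables (m : nat) (X : cohomology m) (B : nat) (x : ordered_basis X B).
Variables (n : nat) (i j : 'I_n).
Hypotheses (m_gt0 : (0 < m)%N) (neq_ij : i != j).
Local Notation deg := (bas_deg x).
Local Notation state := ({ffun 'I_n -> 'I_B} * bool)%type.
Local Notation V := {ffun state -> rat^o}.
Implicit Types (a : {ffun 'I_n -> 'I_B}) (k l : 'I_n) (b : 'I_B) (f : V).

Definition upd (a : {ffun 'I_n -> 'I_B}) k b : {ffun 'I_n -> 'I_B} :=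
  [ffun l => if l == k then b else a l].

Definition predeg (k : 'I_n) (a : {ffun 'I_n -> 'I_B}) : nat :=
  \sum_(l < n | (l < k)%N) deg (a l).

(* If the matrix entry from x_b to x_(s k) is nonzero for a homogeneous y, then
   deg (s k) + deg b has the parity of |y|: the sign is the Koszul sign for
   moving y across the slots before k. *)
Definition mul_op (k : 'I_n) (y : X) (f : V) : V :=
  [ffun s : state => \sum_b (-1) ^+ ((deg (s.1 k) + deg b) * predeg k s.1) *
     lmul_coef x y b (s.1 k) * f (upd s.1 k b, s.2)].

(* The flag of a state records the exterior generator, which sits after all the
   slots. *)
Definition ext_op (f : V) : V :=
  [ffun s : state => if s.2 then (-1) ^+ (\sum_l deg (s.1 l)) * f (s.1, false)
                     else 0].

(* The slot j is unused: p_j acts through the slot i. *)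
Definition kriz_op (g : kgen X n) (f : V) : V :=
  match g with
  | Kp k y => mul_op (if k == j then i else k) y f
  | KG k l => if ((k, l) == (i, j)) || ((k, l) == (j, i)) then ext_op f else 0
  end.

Lemma updE a k b l : upd a k b l = if l == k then b else a l.
Proof. by rewrite ffunE. Qed.

Lemma upd_id a k : upd a k (a k) = a.
Proof. by apply/ffunP=> l; rewrite updE; case: eqP => [->|]. Qed.

Lemma upd_upd a k b c : upd (upd a k b) k c = upd a k c.
Proof. by apply/ffunP=> l; rewrite !updE; case: eqP. Qed.

Lemma updC a k l b c : k != l -> upd (upd a k b) l c = upd (upd a l c) k b.
Proof.
move=> kl; apply/ffunP=> r; rewrite !updE.
by case: (eqVneq r l) => // ->; rewrite eq_sym (negPf kl).
Qed.

Lemma predeg_updl a k l b : (l <= k)%N -> predeg l (upd a k b) = predeg l a.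
Proof.
move=> le_lk; apply: eq_bigr => r lt_rl; rewrite updE -val_eqE /=.
by rewrite ltn_eqF // (leq_trans lt_rl).
Qed.

(** The additive form avoids truncated subtraction; only its parity is used, to compare Koszul
    signs. *)
Lemma predeg_updr a k l b : (k < l)%N ->
  (predeg l (upd a k b) + deg (a k) = predeg l a + deg b)%N.
Proof.
move=> lt_kl; rewrite /predeg (bigD1 k) //= [in RHS](bigD1 k) //= updE eqxx.
rewrite addnC addnA [RHS]addnAC; congr (_ + _)%N.
by apply: eq_bigr => r /andP[_ /negPf rk]; rewrite updE rk.
Qed.

Lemma sumdeg_upd a k b :
  (\sum_l deg (upd a k b l) + deg (a k) = \sum_l deg (a l) + deg b)%N.
Proof.
rewrite (bigD1 k) //= [in RHS](bigD1 k) //= updE eqxx.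
rewrite addnC addnA [RHS]addnAC; congr (_ + _)%N.
by apply: eq_bigr => r /negPf rk; rewrite updE rk.
Qed.

Lemma signr_eq (R : pzRingType) e e' :
  odd e = odd e' -> (-1) ^+ e = (-1) ^+ e' :> R.
Proof. by rewrite -signr_odd => ->; rewrite signr_odd. Qed.

Lemma kriz_op_linear g (a : rat) (u v : V) :
  kriz_op g (a *: u + v) = a *: kriz_op g u + kriz_op g v.
Proof.
have scE (r q : rat^o) : r *: q = r * q :> rat by [].
case: g => [k y|k l] /=.
  apply/ffunP=> s; rewrite !ffunE scE mulr_sumr -big_split; apply: eq_bigr => b _.
  by rewrite !ffunE scE mulrDr /= mulrCA.
case: ifP => _; last by rewrite scaler0 addr0.
apply/ffunP=> s; rewrite !ffunE; case: s.2; last by rewrite scaler0 addr0.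
by rewrite scE mulrDr mulrCA.
Qed.

Lemma mul_op_linear k (a : rat) y z f :
  mul_op k (a *: y + z) f = a *: mul_op k y f + mul_op k z f.
Proof.
have scE (r q : rat^o) : r *: q = r * q :> rat by [].
apply/ffunP=> s; rewrite !ffunE scE mulr_sumr -big_split; apply: eq_bigr => b _.
by rewrite lmul_coef_linear /= mulrDr mulrDl mulrCA !mulrA.
Qed.

Lemma mul_op1 k f : mul_op k 1 f = f.
Proof.
apply/ffunP=> [[a e]]; rewrite !ffunE (bigD1 (a k)) //= big1 ?addr0 => [|b].
  rewrite lmul_coef1 eqxx mulr1 upd_id -signr_odd oddM addnn odd_double.
  by rewrite mul1r.
by rewrite lmul_coef1 eq_sym => /negPf ->; rewrite mulr0 mul0r.
Qed.

(** Composition in one slot is a product of matrices. The degree of the intermediate basis element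
    occurs twice in the exponent and drops out modulo 2. *)
Lemma mul_opM k y z f : mul_op k (y * z) f = mul_op k y (mul_op k z f).
Proof.
apply/ffunP=> [[a e]]; rewrite !ffunE /=.
under eq_bigr do rewrite lmul_coefM mulr_sumr mulr_suml.
rewrite exchange_big; apply: eq_bigr => b _.
rewrite ffunE mulr_sumr; apply: eq_bigr => c _ /=.
rewrite predeg_updl // updE eqxx upd_upd [RHS]mulrA [in RHS]mulrACA -exprD.
congr (_ * _ * _); apply: signr_eq; rewrite -mulnDl !oddM !oddD.
by do 4!case: (odd _).
Qed.

(** Acting in slot [k] shifts the degree preceding slot [l] by [p], whereas acting in slot [l] does
    not affect what precedes [k]. This asymmetry is the sign. *)
Lemma mul_op_lt_gcomm k l p q y z f : (k < l)%N ->
  y \in coh X p -> z \in coh X q ->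
  mul_op k y (mul_op l z f) = (-1) ^+ (p * q) *: mul_op l z (mul_op k y f).
Proof.
move=> lt_kl yp zq; have neq_kl : k != l by rewrite neq_ltn lt_kl.
apply/ffunP=> [[a e]]; rewrite !ffunE /=.
rewrite -[RHS]/(_ * _) mulr_sumr.
under eq_bigr do rewrite ffunE mulr_sumr.
rewrite exchange_big; apply: eq_bigr => c _; rewrite ffunE !mulr_sumr.
apply: eq_bigr => b _ /=; rewrite !updE (negPf neq_kl) eq_sym (negPf neq_kl).
rewrite (predeg_updl _ _ (ltnW lt_kl)) (updC _ _ _ neq_kl).
(* For nonzero matrix entries the degree shifts are exactly [p] and [q], so only a parity count is
   left. *)
have [->|yb] := eqVneq (lmul_coef x y b (a k)) 0; first by rewrite !(mulr0, mul0r).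
have [->|zc] := eqVneq (lmul_coef x z c (a l)) 0; first by rewrite !(mulr0, mul0r).
have /(congr1 odd) := predeg_updr a b lt_kl.
rewrite (lmul_coef_homog yp yb) (lmul_coef_homog zq zc) !mulrA.
rewrite !oddD => odd_pre.
rewrite [in LHS](mulrAC _ (lmul_coef x y b _)) -!exprD.
rewrite [in RHS](mulrAC _ (lmul_coef x z c _)) -!exprD.
congr (_ * _); rewrite mulrAC; congr (_ * _ * _); apply: signr_eq.
rewrite !(oddD, oddM); move: odd_pre; by do 7!case: (odd _).
Qed.

Lemma mul_op_gcomm k l p q y z f : y \in coh X p -> z \in coh X q ->
  mul_op k y (mul_op l z f) = (-1) ^+ (p * q) *: mul_op l z (mul_op k y f).
Proof.
move=> yp zq; case: (ltngtP k l) => [lt_kl|lt_lk|/val_inj <-].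
- exact: mul_op_lt_gcomm.
- by rewrite (mul_op_lt_gcomm f lt_lk zq yp) mulnC scalerA -exprD addnn
    -signr_odd odd_double scale1r.
(* In a common slot the claim is graded commutativity of the cohomology algebra itself. Distinct
   projections reach this case too, since [p_j] acts through slot [i]. *)
rewrite -!mul_opM (coh_gcomm yp zq) -signr_odd mulr_sign -[in RHS]signr_odd.
case: (odd _); rewrite ?scale1r // scaleN1r.
have -> : - (z * y) = (-1 : rat) *: (z * y) + 0 by rewrite scaleN1r addr0.
rewrite mul_op_linear scaleN1r.
have -> : mul_op k 0 f = 0; last by rewrite addr0.
apply/ffunP=> s; rewrite !ffunE big1 // => b _.
by rewrite /lmul_coef mul0r linear0 mulr0 mul0r.
Qed.

(** The exterior generator crosses all slots, whose total degree is shifted by [p]. Since [m] is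
    positive, [m.*2.-1] is odd and the expected sign is that of [p]. *)
Lemma mul_ext_gcomm k p y f : y \in coh X p ->
  mul_op k y (ext_op f) = (-1) ^+ (p * m.*2.-1) *: ext_op (mul_op k y f).
Proof.
move=> yp; have odd_m : odd m.*2.-1.
  by rewrite -(prednK m_gt0) doubleS /= odd_double.
apply/ffunP=> [[a e]]; rewrite !ffunE /= -[RHS]/(_ * _).
case: e; last by rewrite mulr0 big1 // => b _; rewrite ffunE mulr0.
rewrite mulrA mulr_sumr; apply: eq_bigr => b _; rewrite ffunE /=.
have [->|yb] := eqVneq (lmul_coef x y b (a k)) 0; first by rewrite !(mulr0, mul0r).
have /(congr1 odd) := sumdeg_upd a k b.
rewrite (lmul_coef_homog yp yb) !mulrA !oddD => odd_sum; congr (_ * _).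
rewrite [in LHS]mulrAC -!exprD; congr (_ * _); apply: signr_eq.
rewrite !(oddD, oddM) odd_m; move: odd_sum; by do 5!case: (odd _).
Qed.

Lemma ext_op_ext f : ext_op (ext_op f) = 0.
Proof. by apply/ffunP=> [[a []]]; rewrite !ffunE //= mulr0. Qed.

Lemma mul_op0 k y : mul_op k y 0 = 0.
Proof.
by apply/ffunP=> s; rewrite !ffunE big1 // => b _; rewrite ffunE mulr0.
Qed.

Lemma kriz_op0 g : kriz_op g 0 = 0.
Proof.
have := kriz_op_linear g (-1) 0 0.
by rewrite scaler0 addr0 scaleN1r addNr.
Qed.

(** With a single exterior generator of square zero, every relation quadratic in the [G]'s, in
    particular the Arnold relation, reads [0 = 0]. *)
Lemma kG_op_op k l p q f : kriz_op (KG k l) (kriz_op (KG p q) f) = 0.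
Proof.
rewrite [kriz_op (KG p q) f]/=; case: ifP => _; last exact: kriz_op0.
by rewrite /=; case: ifP => // _; apply: ext_op_ext.
Qed.

Lemma kriz_op_rel s t : krel s t -> aeval kriz_op s =1 aeval kriz_op t.
Proof.
case=> {s t} [k a y z|k|k y z|g h p q gp hq|k|k l|k l y lt_kl|k l r _] f.
- exact: mul_op_linear.
- exact: mul_op1.
- exact: mul_opM.
- case: g gp => [k y|k l] gp; case: h hq => [k' z|k' l'] hq.
  + exact: mul_op_gcomm.
  + rewrite /=; move: (if k == j then i else k) => r.
    case: ifP => _; last by rewrite mul_op0 scaler0.
    by rewrite (hq : q = _) (mul_ext_gcomm r f gp).
  + rewrite /=; move: (if k' == j then i else k') => r.
    case: ifP => _; last by rewrite mul_op0 scaler0.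
    rewrite (gp : p = _) (mul_ext_gcomm r f hq) scalerA mulnC -exprD addnn.
    by rewrite -signr_odd odd_double scale1r.
  + rewrite -[LHS]/(kriz_op (KG k l) (kriz_op (KG k' l') f)).
    rewrite -[RHS]/(_ *: kriz_op (KG k' l') (kriz_op (KG k l) f)).
    by rewrite !kG_op_op scaler0.
- rewrite /= !xpair_eqE.
  by case: (eqVneq k i) => [->|_] /=; rewrite ?(negPf neq_ij) ?andbF.
- by rewrite /= !xpair_eqE orbC andbC [X in _ || X]andbC.
(* Unless [G] is the surviving generator both sides are 0; for that generator both projections act
   through slot [i]. *)
- rewrite [LHS]/= [RHS]/= !xpair_eqE.
  case: (boolP (_ || _)) => [|_]; last by rewrite !mul_op0.
  by case/orP=> /andP[/eqP-> /eqP->]; rewrite eqxx (negPf neq_ij).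
- rewrite -[LHS]/(kriz_op (KG k r) (kriz_op (KG l r) f)).
  rewrite -[RHS]/(kriz_op (KG k l) (kriz_op (KG l r) f) +
    - 1 *: kriz_op (KG k l) (kriz_op (KG k r) f)).
  by rewrite !kG_op_op scaler0 addr0.
Qed.

End Model.

Lemma index_enumE (T : finType) : index_enum T = enum T.
Proof. by rewrite [index_enum T]unlock enumT. Qed.

(** * Functionals that separate the monomials with one exterior generator *)

Section MonomialCoefficients.

Variables (m : nat) (X : cohomology m) (B : nat) (x : ordered_basis X B).
Variables (n : nat) (o : 'I_B).
Hypotheses (m_gt0 : (0 < m)%N) (xo : x o = 1).
Local Notation state := ({ffun 'I_n -> 'I_B} * bool)%type.
Local Notation V := {ffun state -> rat^o}.
Implicit Types (a b : {ffun 'I_n -> 'I_B}) (i j k : 'I_n).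

Definition delta (s : state) : V := [ffun t => (t == s)%:R].

Definition vacuum : {ffun 'I_n -> 'I_B} := [ffun=> o].

(** Slot [k] holds the unit, so multiplication writes [x c] there; the slots before it have total
    degree 0, so no sign appears. *)
Lemma mul_op_delta k c a e : a k = o -> predeg x k a = 0%N ->
  mul_op x k (x c) (delta (a, e)) = delta (upd a k c, e).
Proof.
move=> ak pre0; apply/ffunP=> [[t e']]; rewrite !ffunE /= (bigD1 o) //= big1.
  rewrite addr0 ffunE !xpair_eqE /lmul_coef xo mulr1 coord_bas.
  have [ta|ta] := eqVneq (upd t k o) a; last first.
    rewrite mulr0; case: eqP => //= t_a; case/eqP: ta.
    by rewrite t_a upd_upd -ak upd_id.
  rewrite -(predeg_updl x t o (leqnn k)) ta pre0 muln0 mul1r.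
  have -> : (t == upd a k c) = (t k == c); last by rewrite -natrM mulnb.
  apply/eqP/eqP => [->|<-]; first by rewrite updE eqxx.
  by rewrite -ta upd_upd upd_id.
move=> b /negPf bo; rewrite ffunE xpair_eqE.
suff /negPf -> : upd t k b != a by rewrite mulr0.
by apply/eqP=> /ffunP/(_ k)/eqP; rewrite updE eqxx ak bo.
Qed.

Section Pair.

Variables i j : 'I_n.
Hypothesis neq_ij : i != j.

Local Notation ev := (@peval _ _ (@krel m X n) _ (kriz_op x i j)).

Let lin := kriz_op_linear x i j.
Let rel := kriz_op_rel x m_gt0 neq_ij.

(** The last factor acts first, so each class is inserted while all earlier slots still hold the
    unit, and no sign accumulates. *)
Lemma peval_kmono a e : a j = o ->
  ev (kmono x a) (delta (vacuum, e)) = delta (a, e).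
Proof.
move=> aj.
have -> : kmono x a = \prod_(k <- enum 'I_n) kp k (x (a k)) by rewrite -index_enumE.
(* Restricting [a] to the listed positions gives a claim for every suffix of the enumeration, as the
   induction requires. *)
have -> : a = [ffun l => if l \in enum 'I_n then a l else o].
  by apply/ffunP=> l; rewrite ffunE mem_enum.
rewrite [in LHS]big_seq; under eq_bigr => k kn do rewrite ffunE kn.
rewrite -big_seq.
have: sorted ltn (map val (enum 'I_n)) by rewrite val_enum_ord iota_ltn_sorted.
rewrite sorted_map; elim: (enum 'I_n) => [_|k r IHr /= r_path].
  by rewrite big_nil (peval1 lin rel).
rewrite big_cons.
rewrite (pevalM lin rel) IHr; last first.
  exact: path_sorted r_path.
have r_gt l : l \in r -> (k < l)%N.
  have /allP := order_path_min (fun u v w => @ltn_trans _ _ _) r_path.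
  by apply.
have rk : k \notin r by apply/negP=> /r_gt; rewrite ltnn.
have -> : [ffun l => if l \in k :: r then a l else o] =
    upd [ffun l => if l \in r then a l else o] k (a k).
  by apply/ffunP=> l; rewrite updE !ffunE inE; case: eqP => [->|].
(* The factor at [j] would act in slot [i]; it is harmless because its class is 1. *)
have [kj|kj] := eqVneq k j.
  rewrite kj aj xo kp1 (peval1 lin rel).
  congr (delta (_, e)); apply/ffunP=> l; rewrite updE ffunE.
  by case: eqP => // ->; rewrite -kj (negPf rk).
rewrite (peval_cls lin rel) /= (negPf kj) mul_op_delta //.
  by rewrite ffunE (negPf rk).
rewrite /predeg big1 // => l lt_lk; rewrite ffunE.
case: ifP => [/r_gt|_]; first by rewrite ltnNge ltnW.
exact: bas_deg1.
Qed.

Lemma ext_op_vacuum : ext_op x (delta (vacuum, false)) = delta (vacuum, true).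
Proof.
apply/ffunP=> [[a e]]; rewrite !ffunE /= !xpair_eqE eqxx andbT.
case: e; last by rewrite andbF.
rewrite andbT; have [->|] := eqVneq a vacuum; last by rewrite mulr0.
by rewrite big1 // => l _; rewrite ffunE; apply: bas_deg1.
Qed.

(** The functional dual to the monomial with classes [a] and factor [G_ij], among the monomials
    whose second index carries the class 1. *)
Definition kcoef a (u : kriz X n) : rat := ev u (delta (vacuum, false)) (a, true).

Lemma kcoef_linear a c u v : kcoef a (c *: u + v) = c * kcoef a u + kcoef a v.
Proof.
rewrite /kcoef (pevalD lin rel).
by rewrite (pevalZ lin rel) !ffunE.
Qed.

End Pair.

Lemma kcoef_mono i j a i' j' a' : (i < j)%N -> (i' < j')%N -> a' j' = o ->
  kcoef i j a (kmono x a' * kG X i' j') = ((a', (i', j')) == (a, (i, j)))%:R.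
Proof.
move=> lt_ij lt_ij' aj'; have neq_ij : i != j by rewrite neq_ltn lt_ij.
rewrite /kcoef (pevalM (kriz_op_linear x i j) (kriz_op_rel x m_gt0 neq_ij)).
rewrite (peval_cls (kriz_op_linear x i j) (kriz_op_rel x m_gt0 neq_ij)) /=.
rewrite !xpair_eqE; have [ij|_] := boolP ((i' == i) && (j' == j)).
  have /andP[_ /eqP jj] := ij.
  rewrite andbT ext_op_vacuum peval_kmono //; last by rewrite -jj.
  by rewrite ffunE xpair_eqE andbT eq_sym.
(* Both pairs are increasing, so one cannot be the reverse of the other; any remaining [G] acts by
   0. *)
have -> : (i' == j) && (j' == i) = false.
  by apply/negP=> /andP[/eqP ij /eqP ji]; move: lt_ij'; rewrite ij ji ltnNge ltnW.
by rewrite (peval_op0 (kriz_op_linear x i j)) ffunE; case: (a' == a).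
Qed.

End MonomialCoefficients.

(** * Signs in the action of permutations on monomials *)

Section MonomialSigns.

Variables (m : nat) (X : cohomology m) (B : nat) (x : ordered_basis X B) (n : nat).
Hypothesis m_gt0 : (0 < m)%N.
Local Notation deg := (bas_deg x).
Implicit Types (a b : {ffun 'I_n -> 'I_B}) (i j k l : 'I_n) (s t : 'S_n).
Implicit Types (u v : kriz X n).

Lemma kact_mul s t u : kact (s * t) u = kact t (kact s u).
Proof.
rewrite -[u]clsK /kact !(pmap_cls (kren_rel _ m_gt0)); congr cls.
elim: (generic_quotient.repr u) => //= [g|p -> q ->|c p ->|p -> q ->] //.
by congr Agen; case: g => [k y|k l] /=; rewrite !permM.
Qed.

Lemma kact_id u : kact 1 u = u.
Proof.
rewrite -[u in RHS]clsK /kact /pmap; congr cls.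
elim: (generic_quotient.repr u) => //= [g|p -> q ->|c p ->|p -> q ->] //.
by congr Agen; case: g => [k y|k l] /=; rewrite !perm1.
Qed.

Lemma kactZ s c u : kact s (c *: u) = c *: kact s u.
Proof.
have kact0 : kact s (0 : kriz X n) = 0.
  have := kact_linear s m_gt0 (-1) (0 : kriz X n) 0.
  by rewrite scaler0 addr0 scaleN1r addNr.
by rewrite -[c *: u]addr0 kact_linear // kact0 addr0.
Qed.

Lemma kact_prod s (r : seq 'I_n) (f : 'I_n -> X) :
  kact s (\prod_(i <- r) kp i (f i)) = \prod_(i <- r) kp (s i) (f i).
Proof.
rewrite (big_morph (kact s) (kactM s m_gt0) (kact1 _ s m_gt0)).
by apply: eq_bigr => i _; rewrite kact_p.
Qed.

(** A substitute for homogeneity of degree [d], recording only the signs with which [u] passes the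
    generators. *)
Definition gcommuting d u := forall g e, kgen_deg g e ->
  u * cls (@krel m X n) (Agen g) =
  (-1) ^+ (d * e) *: (cls (@krel m X n) (Agen g) * u).

Lemma gcommuting_prod (r : seq 'I_n) (f : 'I_n -> 'I_n) a :
  gcommuting (\sum_(i <- r) deg (a i)) (\prod_(i <- r) kp (f i) (x (a i))).
Proof.
move=> g e ge; elim: r => [|i r IHr].
  by rewrite !big_nil mul1r mulr1 mul0n scale1r.
rewrite !big_cons mulnDl exprD -mulrA IHr -presented_scaleAr !mulrA.
rewrite -scalerA [RHS]scalerA mulrC -[RHS]scalerA -mulrA; congr (_ *: _).
have yi : kgen_deg (Kp (f i) (x (a i))) (deg (a i)) by apply: bas_homog.
by rewrite mulrA [X in X * _](kgen_gcomm yi ge) -presented_scaleAl.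
Qed.

Lemma split_enum k l : k != l -> exists r1 r2 r3,
  enum 'I_n = r1 ++ k :: r2 ++ l :: r3 \/ enum 'I_n = r1 ++ l :: r2 ++ k :: r3.
Proof.
move=> kl; have := mem_enum 'I_n k; have := mem_enum 'I_n l.
case/splitPr => [r1 r2]; rewrite mem_cat inE (negPf kl) /=.
case/orP => /splitPr[p1 p2].
  by exists p1, p2, r2; left; rewrite -catA.
by exists r1, p1, p2; right.
Qed.

(** The inverse carries the class at [i] to [s i], which makes this a right action compatible with
    [kact]. *)
Definition permute a s : {ffun 'I_n -> 'I_B} := [ffun i => a ((s^-1)%g i)].

Lemma permuteM a s t : permute a (s * t) = permute (permute a s) t.
Proof. by apply/ffunP=> i; rewrite !ffunE invMg permM. Qed.

Lemma permuteE a s i : permute a s (s i) = a i.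
Proof. by rewrite ffunE permK. Qed.

Lemma permute1 a : permute a 1 = a.
Proof. by apply/ffunP=> i; rewrite ffunE invg1 perm1. Qed.

Lemma kmono_enum a : kmono x a = \prod_(k <- enum 'I_n) kp k (x (a k)).
Proof. by rewrite -index_enumE. Qed.

Lemma split_fresh k l r1 r2 r3 i : enum 'I_n = r1 ++ k :: r2 ++ l :: r3 ->
  i \in r1 ++ r2 ++ r3 -> (i != k) && (i != l).
Proof.
move=> enum_n; have := enum_uniq 'I_n; rewrite enum_n.
rewrite (perm_uniq (_ : perm_eq _ (k :: l :: r1 ++ r2 ++ r3))); last first.
  by apply/seq.permP=> P; rewrite /= !count_cat /= !count_cat /=; ring.
rewrite /= inE negb_or => /and3P[/andP[_ kr] lr _] ir.
by apply/andP; split; [apply: contraNneq kr | apply: contraNneq lr] => <-.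
Qed.

Lemma kact_tperm_split k l r1 r2 r3 a : enum 'I_n = r1 ++ k :: r2 ++ l :: r3 ->
  exists e,
    kact (tperm k l) (kmono x a) = (-1) ^+ e *: kmono x (permute a (tperm k l)) /\
    (a k = a l -> odd e = odd (deg (a k))).
Proof.
move=> enum_n; have fresh := split_fresh enum_n.
pose d2 := (\sum_(i <- r2) deg (a i))%N.
(* The two classes cross the middle block, of degree [d2], and each other. For equal classes the
   block crossings cancel modulo 2, and a square has the parity of its root. *)
exists (d2 * deg (a k) + (deg (a k) * deg (a l) + d2 * deg (a l)))%N.
split=> [|->]; last by rewrite !(oddD, oddM); do 2!case: (odd _).
pose P (r : seq 'I_n) : kriz X n := \prod_(i <- r) kp i (x (a i)).
have actP (r : seq 'I_n) : {subset r <= r1 ++ r2 ++ r3} ->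
    \prod_(i <- r) kp (tperm k l i) (x (a i)) = P r.
  move=> sub_r; rewrite big_seq [RHS]big_seq.
  apply: eq_bigr => i /sub_r/fresh/andP[ik il].
  by rewrite tpermD // eq_sym.
have permP (r : seq 'I_n) : {subset r <= r1 ++ r2 ++ r3} ->
    \prod_(i <- r) kp i (x (permute a (tperm k l) i)) = P r.
  move=> sub_r; rewrite big_seq [RHS]big_seq.
  apply: eq_bigr => i /sub_r/fresh/andP[ik il].
  by rewrite ffunE tpermV tpermD // eq_sym.
have sub1 : {subset r1 <= r1 ++ r2 ++ r3}.
  by move=> i ir; rewrite mem_cat ir.
have sub2 : {subset r2 <= r1 ++ r2 ++ r3}.
  by move=> i ir; rewrite !mem_cat ir orbT.
have sub3 : {subset r3 <= r1 ++ r2 ++ r3}.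
  by move=> i ir; rewrite !mem_cat ir !orbT.
rewrite kmono_enum kact_prod [in RHS]kmono_enum enum_n.
rewrite !(big_cat, big_cons) /= !actP // !permP // !ffunE tpermV tpermL tpermR.
pose ak := kp (n := n) l (x (a k)); pose al := kp (n := n) k (x (a l)).
rewrite -/ak -/al.
have cP (i j : 'I_n) : P r2 * kp j (x (a i)) =
    (-1) ^+ (d2 * deg (a i)) *: (kp j (x (a i)) * P r2).
  have yj : kgen_deg (Kp j (x (a i))) (deg (a i)) by apply: bas_homog.
  exact: (gcommuting_prod r2 id a yj).
have swap : ak * al = (-1) ^+ (deg (a k) * deg (a l)) *: (al * ak).
  apply: (@kgen_gcomm _ _ _ (Kp l (x (a k))) (Kp k (x (a l)))); exact: bas_homog.
rewrite presented_scaleAr; congr (_ * _).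
rewrite !(mulrA (P r2)) !cP -!presented_scaleAl -!presented_scaleAr !mulrA swap.
rewrite -!presented_scaleAl !scalerA -!exprD; congr (_ *: _); apply: signr_eq.
by rewrite !oddD; do 3!case: (odd _).
Qed.

Lemma kact_tperm_kmono k l a : k != l -> exists e,
  kact (tperm k l) (kmono x a) = (-1) ^+ e *: kmono x (permute a (tperm k l)) /\
  (a k = a l -> odd e = odd (deg (a k))).
Proof.
move=> /split_enum[r1 [r2 [r3 [enum_n|enum_n]]]].
  exact: kact_tperm_split enum_n.
have [e [act_e odd_e]] := kact_tperm_split a enum_n.
by exists e; rewrite tpermC; split=> // akl; rewrite akl odd_e.
Qed.

(** A permutation is a product of transpositions, each costing a sign. The exponent is left
    unspecified: later uses need only that the scalar is invertible. *)
Lemma kact_kmono s a : exists e : nat,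
  kact s (kmono x a) = (-1) ^+ e *: kmono x (permute a s).
Proof.
have [ts -> ts_d] := prod_tpermP s.
elim: ts ts_d a => [_ a|[k l] ts IHts /= /andP[kl ts_d] a].
  by exists 0%N; rewrite big_nil kact_id permute1 scale1r.
have [e [act_e _]] := kact_tperm_kmono a kl.
have [e' act_e'] := IHts ts_d (permute a (tperm k l)).
exists (e + e')%N.
by rewrite big_cons kact_mul act_e kactZ act_e' scalerA permuteM exprD.
Qed.

Definition kmonoG a i j : kriz X n := kmono x a * kG X i j.

Lemma kact_kmonoG s a i j : exists e : nat,
  kact s (kmonoG a i j) = (-1) ^+ e *: kmonoG (permute a s) (s i) (s j).
Proof.
have [e act_e] := kact_kmono s a.
by exists e; rewrite kactM // act_e kact_G // presented_scaleAl.
Qed.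

Lemma kact_tperm_kmonoG k l a i j :
  k != l -> k != i -> k != j -> l != i -> l != j -> a k = a l ->
  kact (tperm k l) (kmonoG a i j) = (-1) ^+ deg (a k) *: kmonoG a i j.
Proof.
move=> kl ki kj li lj akl; have [e [act_e odd_e]] := kact_tperm_kmono a kl.
rewrite kactM // act_e kact_G // !tpermD // -presented_scaleAl.
rewrite (signr_eq _ (odd_e akl)); congr (_ *: (kmono x _ * _)).
by apply/ffunP=> p; rewrite ffunE tpermV; case: tpermP => // ->.
Qed.

(** Moving [u] past [kG X i j] brings the latter next to the projection, where [kG_pG] applies; the
    same sign arises on both sides. *)
Lemma kp_gcommuting_kG d u i j y :
  gcommuting d u -> kp j y * (u * kG X i j) = kp i y * (u * kG X i j).
Proof.
move=> /(_ (KG i j) _ erefl) ->; rewrite -!presented_scaleAr !mulrA.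
by rewrite [X in X * _]kG_pG.
Qed.

(* Since the class at j is 1, the class at i may be moved to j and back. *)
Lemma kact_tperm_pair i j a : i != j -> x (a j) = 1 ->
  kact (tperm i j) (kmonoG a i j) = kmonoG a i j.
Proof.
move=> ij aj; have [r1 [r2 [r3 enum_n]]] := split_enum ij.
have fresh p : p \in r1 ++ r2 ++ r3 -> (p != i) && (p != j).
  by case: enum_n => /split_fresh fresh /fresh //; rewrite andbC.
pose P (r : seq 'I_n) : kriz X n := \prod_(p <- r) kp p (x (a p)).
have actP (r : seq 'I_n) : {subset r <= r1 ++ r2 ++ r3} ->
    \prod_(p <- r) kp (tperm i j p) (x (a p)) = P r.
  move=> sub_r; rewrite big_seq [RHS]big_seq.
  apply: eq_bigr => p /sub_r/fresh/andP[pi pj].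
  by rewrite tpermD // eq_sym.
have sub1 : {subset r1 <= r1 ++ r2 ++ r3}.
  by move=> p pr; rewrite mem_cat pr.
have sub2 : {subset r2 <= r1 ++ r2 ++ r3}.
  by move=> p pr; rewrite !mem_cat pr orbT.
have sub3 : {subset r3 <= r1 ++ r2 ++ r3}.
  by move=> p pr; rewrite !mem_cat pr !orbT.
rewrite kactM // kact_G // tpermL tpermR kG_sym /kmonoG kmono_enum kact_prod.
case: enum_n => ->; rewrite !(big_cat, big_cons) /= !actP // tpermL tpermR aj !kp1.
  rewrite -!/(P _) !mul1r -!mulrA; congr (_ * _); rewrite !(mulrA (P r2)).
  rewrite -big_cat; apply: kp_gcommuting_kG; exact: gcommuting_prod.
rewrite -!/(P _) !mul1r -!mulrA; congr (_ * (_ * _)).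
by apply: kp_gcommuting_kG; exact: gcommuting_prod.
Qed.

End MonomialSigns.

(** * Recognition of a module induced from a one-dimensional representation *)

Section InducedFromCharacter.

Variables (F : fieldType) (gT : finGroupType) (H : {group gT}).
Variables (V : lmodType F) (act : gT -> V -> V).
Hypothesis act_linear :
  forall g a u v, act g (a *: u + v) = a *: act g u + act g v.
Hypothesis act_mul : forall g h v, act (g * h)%g v = act h (act g v).

Lemma act_sum g (I : finType) (c : I -> F) (f : I -> V) :
  act g (\sum_i c i *: f i) = \sum_i c i *: act g (f i).
Proof.
have act0 : act g 0 = 0.
  by have := act_linear g (-1) 0 0; rewrite scaler0 addr0 scaleN1r addNr.
by elim/big_rec2: _ => // i u v _ <-; rewrite act_linear.
Qed.

(** The coordinates of a row vector become coefficients on the coset translates of [e]. The degree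
    is a variable, and the character a trace, because the Young module has degree 1 only through a
    proved equation. *)
Lemma submodule_iso_ind d (rH : mx_representation F H d) (e : V) (U : V -> Prop) :
  d = 1%N ->
  (forall h, h \in H -> act h e = \tr (rH h) *: e) ->
  (forall c : 'I_#|rcosets H [set: gT]| -> F,
     \sum_i c i *: act (coset_rep i) e = 0 -> forall i, c i = 0) ->
  (forall v, U v <-> exists c : 'I_#|rcosets H [set: gT]| -> F,
     v = \sum_i c i *: act (coset_rep i) e) ->
  submodule_iso act U (ind_repr rH).
Proof.
move=> d1; subst d => He e_free UE.
pose phi (u : 'rV[F]_(\sum_(i < #|rcosets H [set: gT]|) 1)) : V :=
  \sum_i (submxrow u i) 0 0 *: act (coset_rep i) e.
have phi_linear : linear phi.
  move=> a u v; rewrite /phi scaler_sumr -big_split; apply: eq_bigr => i _ /=.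
  by rewrite !mxE scalerA -scalerDl.
pose phiM := GRing.isLinear.Build _ _ _ _ phi phi_linear.
pose Phi : {linear _ -> V} := HB.pack phi phiM.
exists Phi; split.
- move=> u v /eqP; rewrite -subr_eq0 -linearB => /eqP/e_free uv0.
  apply/eqP; rewrite -subr_eq0; apply/eqP/mxrowP => i.
  by rewrite submxrow0; apply/matrixP=> p q; rewrite !ord1 uv0 mxE.
- move=> v; rewrite UE; split=> [[c ->]|[u ->]].
    exists (\mxrow_i (c i)%:M); apply: eq_bigr => i _.
    by rewrite mxrowK mxE eqxx mulr1n.
  by exists (fun i => submxrow u i 0 0).
move=> g u; rewrite /= /phi act_sum.
rewrite [u in LHS](_ : u = \mxrow_i submxrow u i); last by rewrite submxrowK.
rewrite /ind_mx mul_mxrow_mxblock.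
under eq_bigr do rewrite mxrowK summxE scaler_suml.
rewrite exchange_big; apply: eq_bigr => i _ /=.
(* In block row [i] only the column of the coset of [coset_rep i * g] contributes, through the
   factor in [H] relating the two representatives. *)
have [l Hl] := coset_repP g i.
rewrite (bigD1 l) //= big1 => [|j /negPf jl]; last first.
  by rewrite Hl jl mulmx0 mxE scale0r.
have HA : (coset_rep i * g * (coset_rep l)^-1)%g \in H by rewrite Hl.
have -> : act g (act (coset_rep i) e) =
    act (coset_rep l) (act (coset_rep i * g * (coset_rep l)^-1)%g e).
  by rewrite -!act_mul mulgKV.
rewrite addr0 HA (He _ HA).
have actZ c v : act (coset_rep l) (c *: v) = c *: act (coset_rep l) v.
  by have := act_sum (coset_rep l) (fun _ : 'I_1 => c) (fun=> v); rewrite !big_ord1.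
by rewrite actZ scalerA [(_ *m _) 0 0]mxE big_ord1 /mxtrace big_ord1.
Qed.

End InducedFromCharacter.

(** * The Young subgroup and its transpositions *)

Section YoungSubgroup.

Variables (n : nat) (c : seq nat).
Hypothesis sum_c : sumn c = n.
Local Notation idx := (reshape_index c).
Implicit Types (k l : 'I_n) (s : 'S_n).

(** Identifies [reshape_index] with the block number, trading interval bounds for an equation. *)
Lemma in_block k p : (p < size c)%N -> (k \in block n c p) = (idx k == p).
Proof.
move=> lt_p; have lt_k : (k < sumn c)%N by rewrite sum_c.
have take_S q : (q < size c)%N ->
    sumn (take q.+1 c) = (sumn (take q c) + nth 0 c q)%N.
  by move=> lt_q; rewrite (take_nth 0%N lt_q) sumn_rcons.
rewrite inE take_S //; apply/andP/eqP => [[le_pk lt_kp]|<-].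
  rewrite -(subnKC le_pk); apply: flatten_indexKl.
  by rewrite -(ltn_add2l (sumn (take p c))) subnKC.
rewrite -{2 3}(reshape_indexK c k) /flatten_index leq_addr ltn_add2l.
by rewrite reshape_offsetP.
Qed.

Lemma reshape_index_size k : (idx k < size c)%N.
Proof. by rewrite reshape_indexP ?sum_c. Qed.

Lemma youngP s : reflect (forall k, idx (s k) = idx k) (s \in young n c).
Proof.
apply: (iffP bigcapP) => [Ys k|Ys p _].
  have lt_k := reshape_index_size k.
  have /astabsP/(_ k) := Ys (Ordinal lt_k) isT.
  by rewrite /= !in_block // eqxx => /eqP.
by apply/astabsP => k; rewrite /= !in_block // Ys.
Qed.

Lemma tperm_young k l : idx k = idx l -> tperm k l \in young n c.
Proof. by move=> kl; apply/youngP => i; case: tpermP => // ->. Qed.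

(** Descent on the number of moved points: if [s l = k] then [tperm k l * s] fixes [k] and moves
    only points moved by [s], while [k] and [l] share a block. *)
Lemma young_ind (P : 'S_n -> Prop) : P 1%g ->
    (forall k l s, k != l -> idx k = idx l -> s \in young n c -> P s ->
       P (tperm k l * s)%g) ->
  forall s, s \in young n c -> P s.
Proof.
move=> P1 PM s; have [d] := ubnP #|[pred k | s k != k]|.
elim: d s => // d IHd s /ltnSE le_d Ys.
have [k sk|s1] := pickP [pred k | s k != k]; last first.
  suff ->: s = 1%g by [].
  by apply/permP=> k; rewrite perm1; apply/eqP; have /negbFE := s1 k.
pose l := (s^-1 k)%g; have sl : s l = k by rewrite permKV.
have kl : k != l by apply: contraNneq sk => kl; rewrite /= {1}kl sl.
have idx_kl : idx k = idx l by rewrite -sl (youngP _ Ys).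
have Ys' : (tperm k l * s)%g \in young n c by rewrite groupM // tperm_young.
rewrite -[s](mulKg (tperm k l)) tpermV; apply: PM => //; apply: IHd => //.
apply: leq_trans le_d; apply: proper_card; apply/properP; split.
  apply/subsetP=> i; rewrite !inE permM; apply: contraNneq => si.
  case: tpermP => [ik|il|_ _]; last by rewrite si.
    by rewrite sl ik.
  by case/eqP: kl; rewrite -sl -il si.
by exists k; rewrite inE // permM tpermL sl eqxx.
Qed.

Lemma restr_perm_tperm k l p : (p < size c)%N -> idx k = idx l ->
  restr_perm (block n c p) (tperm k l) = if idx k == p then tperm k l else 1%g.
Proof.
move=> lt_p kl; have Nt : tperm k l \in 'N(block n c p | 'P)%g.
  by have /bigcapP/(_ (Ordinal lt_p) isT) := tperm_young kl.
apply/permP=> i; have [ip|ip] := boolP (i \in block n c p).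
  rewrite restr_permE //; case: ifP => // kp; rewrite perm1 tpermD //.
    by apply: contraFneq kp => ->; rewrite -in_block.
  by apply: contraFneq kp => il; rewrite kl il -in_block.
rewrite (out_perm (restr_perm_on _ _) ip); case: ifP => kp; last by rewrite perm1.
rewrite in_block // in ip; rewrite tpermD //.
  by apply: contraNneq ip => <-.
by apply: contraNneq ip => <-; rewrite -kl.
Qed.

(** Both offsets in a block of length 1 are 0. Hence a transposition of distinct points in a block
    never meets the case [r == 1] of [eps_repr]. *)
Lemma reshape_index_inj1 k l : idx k = idx l -> nth 0%N c (idx k) = 1%N -> k = l.
Proof.
move=> kl c1; apply: val_inj.
rewrite /= -(reshape_indexK c k) -(reshape_indexK c l).
have := @reshape_offsetP c k; have := @reshape_offsetP c l.
by rewrite !sum_c !ltn_ord -kl c1 !ltnS !leqn0 => /(_ isT)/eqP-> /(_ isT)/eqP->.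
Qed.

Lemma card_block p : #|[set k : 'I_n | idx k == p]| = nth 0%N c p.
Proof.
have lt_n (q : 'I_(nth 0%N c p)) : (flatten_index c p q < n)%N.
  by rewrite -sum_c flatten_indexP.
pose f q := Ordinal (lt_n q).
have f_inj : injective f.
  by move=> q r /(congr1 val)/= /addnI /val_inj.
rewrite -[RHS]card_ord -cardsT -(card_imset _ f_inj); apply: eq_card => k.
rewrite inE; apply/eqP/imsetP => [kp|[q _ ->]]; last by rewrite /= flatten_indexKl.
have lt_k : (reshape_offset c k < nth 0 c p)%N.
  by rewrite -kp reshape_offsetP ?sum_c.
by exists (Ordinal lt_k) => //; apply: val_inj; rewrite /= -kp reshape_indexK.
Qed.

Lemma mxtrace_foldl_tensor (V : representation rat (young n c))
    (Ws : seq (representation rat (young n c))) s :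
  \tr (foldl (@tensor_repr rat n c) V Ws s) = \tr (V s) * \prod_(W <- Ws) \tr (W s).
Proof.
elim: Ws V => [|W Ws IHWs] V; first by rewrite big_nil mulr1.
by rewrite /= IHWs big_cons mulrA; congr (_ * _); apply: mxtrace_prod.
Qed.

Lemma rdegree_foldl_tensor (V : representation rat (young n c))
    (Ws : seq (representation rat (young n c))) :
  rdegree (foldl (@tensor_repr rat n c) V Ws) =
    (rdegree V * \prod_(W <- Ws) rdegree W)%N.
Proof.
elim: Ws V => [|W Ws IHWs] V; first by rewrite big_nil muln1.
by rewrite /= IHWs big_cons mulnA.
Qed.

End YoungSubgroup.

(** * The character of the inducing module *)

Section YoungModule.

Variables (m : nat) (X : cohomology m) (B : nat) (x : ordered_basis X B).
Variables (n : nat) (hs : seq ('I_B * nat)).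
Hypothesis sum_hs : (2 + sumn (unzip2 hs))%N = n.
Local Notation idx := (reshape_index (composition hs)).
Local Notation M := (young_module x n hs).

Lemma rdegree_young_module : rdegree M = 1%N.
Proof.
rewrite /young_module rdegree_foldl_tensor mul1n big_map.
by rewrite big1 // => l _.
Qed.

(** Only the tensor factor of the block containing [k] and [l] sees the transposition. The product
    has at most one factor and is empty on the first block, whose factor is trivial. *)
Lemma mxtrace_young_tperm (k l : 'I_n) : k != l -> idx k = idx l ->
  \tr (M (tperm k l)) =
    \prod_(p < size hs | idx k == p.+1) (-1) ^+ bas_deg x (tnth (in_tuple hs) p).1.
Proof.
move=> neq_kl kl; rewrite mxtrace_foldl_tensor /= mxtrace1 mul1r big_map.
rewrite big_enum [RHS]big_mkcond; apply: eq_bigr => p _ /=.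
have sum_c : sumn (composition hs) = n by [].
have lt_p : (p.+1 < size (composition hs))%N by rewrite /= size_map ltnS.
rewrite (restr_perm_tperm sum_c lt_p kl); case: eqP => [kp|_]; last first.
  by rewrite repr_mx1 mxtrace1.
have nth_p : nth 0%N (composition hs) p.+1 = (tnth (in_tuple hs) p).2.
  by rewrite /= (nth_map (tnth_default (in_tuple hs) p)) // -tnth_nth.
have /negPf mp : (tnth (in_tuple hs) p).2 != 1%N.
  apply: contra_neqN neq_kl => /eqP mp.
  by apply: (reshape_index_inj1 sum_c kl); rewrite kp nth_p.
rewrite /eps_repr mp /= -[in RHS]signr_odd; case: (odd _) => /=.
  by rewrite mxtrace_scalar odd_tperm neq_kl.
by rewrite mxtrace1.
Qed.

End YoungModule.

(** * Closure properties of linear spans *)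

Section LinearSpan.

Variables (F : pzRingType) (V : lmodType F).

Lemma lin_span_linear (I : finType) (P : pred I) (f : I -> V) a u v :
  lin_span P f u -> lin_span P f v -> lin_span P f (a *: u + v).
Proof.
move=> [c ->] [d ->]; exists (fun i => a * c i + d i).
rewrite scaler_sumr -big_split; apply: eq_bigr => i _ /=.
by rewrite scalerDl scalerA.
Qed.

Lemma lin_span0 (I : finType) (P : pred I) (f : I -> V) : lin_span P f 0.
Proof. by exists (fun=> 0); rewrite big1 // => i _; rewrite scale0r. Qed.

Lemma lin_span_gen (I : finType) (P : pred I) (f : I -> V) a i :
  P i -> lin_span P f (a *: f i).
Proof.
move=> Pi; exists (fun k => if k == i then a else 0).
rewrite (bigD1 i) //= eqxx big1 ?addr0 // => k /andP[_ /negPf ->].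
by rewrite scale0r.
Qed.

Lemma lin_span_trans (I J : finType) (P : pred I) (Q : pred J)
    (f : I -> V) (g : J -> V) v :
  (forall i, P i -> lin_span Q g (f i)) -> lin_span P f v -> lin_span Q g v.
Proof.
move=> fg [c ->]; elim/big_rec: _ => [|i u Pi gu]; first exact: lin_span0.
exact/lin_span_linear/gu/fg.
Qed.

End LinearSpan.

(** Equal fibre sizes make the two tuples of values rearrangements of each other. *)
Lemma perm_of_fibres (T : eqType) n (f g : 'I_n -> T) :
  (forall v, #|[set k | f k == v]| = #|[set k | g k == v]|) ->
  exists s : 'S_n, forall k, g (s k) = f k.
Proof.
move=> fg; have countE (h : 'I_n -> T) v :
    count_mem v [tuple h k | k < n] = #|[set k | h k == v]|.
  rewrite /= count_map cardsE cardE /enum_mem -size_filter -enumT.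
  by congr size; rewrite -filter_predI; apply: eq_filter => k /=; rewrite andbT.
have /tuple_permP[s fs] : perm_eq [tuple f k | k < n] [tuple g k | k < n].
  by apply/allP => v _ /=; rewrite !countE fg.
exists s => k; have /val_inj/(congr1 (fun t => tnth t k)) := fs.
by rewrite !tnth_mktuple.
Qed.

(** * Transitivity of the symmetric group on configurations of a fixed type *)

Section Configurations.

Variables (m : nat) (X : cohomology m) (B : nat) (x : ordered_basis X B) (n : nat).
Variables (h1 o : 'I_B) (hs : seq ('I_B * nat)).
Hypothesis xo : x o = 1.
Hypothesis hs_sorted : sorted (fun u v : 'I_B * nat => (v.1 < u.1)%N) hs.
Hypothesis sum_hs : (2 + sumn (unzip2 hs))%N = n.
Local Notation idx := (reshape_index (composition hs)).
Implicit Types (a b : {ffun 'I_n -> 'I_B}) (i j k l : 'I_n) (s t : 'S_n).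

Definition class_set a i j h : {set 'I_n} :=
  [set k | [&& k != i, k != j & a k == h]].

Lemma of_typeP a i j : reflect
  [/\ (i < j)%N, a i = h1, a j = o &
     {in hs, forall u, #|class_set a i j u.1| = u.2}]
  (of_type x h1 hs a i j).
Proof.
have classE u : #|class_set a i j u| =
    #|[set k | [&& k != i, k != j & x (a k) == x u]]|.
  by apply: eq_card => k; rewrite !inE (inj_eq (@bas_inj _ _ _ x)).
apply: (iffP and4P) => [[lt_ij /eqP/bas_inj ai aj /allP hsP]|[lt_ij -> -> hsP]].
  split=> // [|u /hsP/eqP <-]; last exact: classE.
  by move: aj; rewrite -xo => /eqP/bas_inj.
rewrite xo; split=> //; apply/allP => u /hsP <-.
by rewrite classE.
Qed.

Lemma unzip1_uniq : uniq (unzip1 hs).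
Proof.
have: sorted (fun u v : 'I_B => (v < u)%N) (unzip1 hs) by rewrite sorted_map.
apply: sorted_uniq => [u v w vu wv|u]; last exact: ltnn.
exact: ltn_trans wv vu.
Qed.

(** The multiplicities in [hs] already exhaust the [n - 2] positions away from [i] and [j]. *)
Lemma class_set0 a i j h : of_type x h1 hs a i j -> h \notin unzip1 hs ->
  #|class_set a i j h| = 0%N.
Proof.
case/of_typeP=> lt_ij _ _ hsP hN.
pose R := [set k | (k != i) && (k != j)].
have cardR : #|R| = sumn (unzip2 hs).
  have -> : R = ~: [set i; j] by apply/setP=> k; rewrite !inE negb_or.
  apply/eqP; rewrite -(eqn_add2l #|[set i; j]|) cardsC card_ord cards2.
  by rewrite -val_eqE neq_ltn lt_ij /= sum_hs.
have: #|R| = (\sum_h #|class_set a i j h|)%N.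
  rewrite -sum1_card (partition_big a predT) //=; apply: eq_bigr => h' _.
  by rewrite -sum1_card; apply: eq_bigl => k; rewrite !inE andbA.
rewrite (bigID (mem (unzip1 hs))) /= -big_uniq ?unzip1_uniq // big_map.
rewrite big_seq (eq_bigr (fun u => u.2)) => [|u /hsP //].
rewrite -big_seq cardR sumnE big_map => /eqP.
rewrite -[X in X == _]addn0 eqn_add2l eq_sym sum_nat_eq0.
by move=> /forallP/(_ h); rewrite hN => /eqP.
Qed.

(** Each position is tagged by whether it is the first or second index of the pair, together with
    its class. The tags force the pair to be matched even when [h1] or [o] recurs in [hs]. *)
Lemma of_type_conj a i j b k l :
  of_type x h1 hs a i j -> of_type x h1 hs b k l ->
  exists s, [/\ s i = k, s j = l & permute a s = b].
Proof.
move=> a_type b_type.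
have [lt_ij ai aj a_hs] := of_typeP _ _ _ a_type.
have [lt_kl bk bl b_hs] := of_typeP _ _ _ b_type.
have class_eq h : #|class_set a i j h| = #|class_set b k l h|.
  have [/mapP[u hs_u ->]|hN] := boolP (h \in unzip1 hs).
    by rewrite a_hs ?b_hs.
  by rewrite !class_set0.
have fibreE (p1 p2 : bool) h a' i' j' :
    (i' < j')%N -> a' i' = h1 -> a' j' = o ->
    [set p | (p == i', p == j', a' p) == (p1, p2, h)] =
    if p1 then if p2 || (h != h1) then set0 else [set i']
    else if p2 then if h != o then set0 else [set j'] else class_set a' i' j' h.
  move=> lt_ij' ai' aj'; have neq_ij' : i' != j' by rewrite neq_ltn lt_ij'.
  apply/setP=> p; rewrite inE !xpair_eqE.
  case: p1 p2 => [] []; rewrite ?eqb_id ?eqbF_neg /=; last by rewrite inE andbA.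
  - rewrite inE; apply/negP=> /andP[/andP[/eqP-> /eqP ij]] _.
    by rewrite ij eqxx in neq_ij'.
  - have [->|pi] := eqVneq p i'; last first.
      by case: ifP; rewrite inE // (negPf pi).
    by rewrite neq_ij' ai' eq_sym; case: eqP; rewrite inE ?eqxx.
  - have [->|pj] := eqVneq p j'.
      by rewrite eq_sym neq_ij' aj' eq_sym; case: eqP; rewrite inE ?eqxx.
    by rewrite andbF; case: ifP; rewrite inE // (negPf pj).
have [|s sP] := @perm_of_fibres _ n (fun p => (p == i, p == j, a p))
                                    (fun p => (p == k, p == l, b p)).
  case=> [[p1 p2] h]; rewrite !fibreE //; case: p1 p2 => [] [] //=.
  - by case: eqP; rewrite /= ?cards1 ?cards0.
  - by case: eqP; rewrite /= ?cards1 ?cards0.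
exists s.
have si : s i = k by have [] := sP i; rewrite eqxx => /eqP.
have sj : s j = l by have [_] := sP j; rewrite eqxx => /eqP.
split=> //; apply/ffunP=> p; rewrite ffunE.
by have [_ _ <-] := sP ((s^-1)%g p); rewrite permKV.
Qed.

Lemma of_type_permute a i j s : (s i < s j)%N -> of_type x h1 hs a i j ->
  of_type x h1 hs (permute a s) (s i) (s j).
Proof.
move=> lt_s /of_typeP[_ ai aj a_hs]; apply/of_typeP; split=> //.
- by rewrite permuteE.
- by rewrite permuteE.
move=> u /a_hs <-; rewrite -[RHS](card_imset _ (@perm_inj _ s)).
apply: eq_card => k; rewrite -[k](permKV s) mem_imset ?inE; last exact: perm_inj.
by rewrite !(inj_eq perm_inj) permuteE.
Qed.

End Configurations.

(** * The standard monomial and its translates *)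

Section StandardConfiguration.

Variables (m : nat) (X : cohomology m) (B : nat) (x : ordered_basis X B) (n : nat).
Variables (h1 o : 'I_B) (hs : seq ('I_B * nat)) (i0 j0 : 'I_n).
Hypotheses (m_gt0 : (0 < m)%N) (xo : x o = 1).
Hypothesis hs_sorted : sorted (fun u v : 'I_B * nat => (v.1 < u.1)%N) hs.
Hypothesis sum_hs : (2 + sumn (unzip2 hs))%N = n.
Hypotheses (i0E : val i0 = 0%N) (j0E : val j0 = 1%N).
Local Notation idx := (reshape_index (composition hs)).
Local Notation Y := (young n (composition hs)).
Local Notation M := (young_module x n hs).
Implicit Types (k l : 'I_n) (s t : 'S_n).

Let sum_c : sumn (composition hs) = n := sum_hs.

(** Block 0 is the pair [i0], [j0], whence the predecessor; the default of [nth] is never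
    reached. *)
Definition std_classes : {ffun 'I_n -> 'I_B} :=
  [ffun k => if k == i0 then h1 else if k == j0 then o
             else nth o (unzip1 hs) (idx k).-1].

Local Notation e0 := (kmonoG x std_classes i0 j0).

Lemma neq_i0j0 : i0 != j0.
Proof. by rewrite -val_eqE i0E j0E. Qed.

Lemma idx_eq0 k : (idx k == 0%N) = (k == i0) || (k == j0).
Proof.
rewrite -(in_block sum_c) // inE /= -!val_eqE i0E j0E /=.
by rewrite take0 addn0; case: (nat_of_ord k) => [|[]].
Qed.

Lemma std_idx k p : idx k = p.+1 -> std_classes k = nth o (unzip1 hs) p.
Proof.
move=> kp; have := idx_eq0 k; rewrite ffunE kp /=.
by case: (k == i0) (k == j0) => [] [].
Qed.

Lemma std_type : of_type x h1 hs std_classes i0 j0.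
Proof.
apply/(of_typeP h1 hs xo); split.
- by rewrite i0E j0E.
- by rewrite ffunE eqxx.
- by rewrite ffunE eqxx eq_sym (negPf neq_i0j0).
move=> u hs_u; pose p := index u hs.
have lt_p : (p < size hs)%N by rewrite index_mem.
have nth_p : nth u hs p = u by rewrite nth_index.
transitivity (nth 0%N (composition hs) p.+1); last first.
  by rewrite /= (nth_map u) // nth_p.
rewrite -(card_block sum_c); apply: eq_card => k; rewrite !inE.
have := idx_eq0 k; have := reshape_index_size sum_c k; rewrite /= size_map.
case kq: (idx k) => [|q] /=.
  by move=> _ /esym/orP[]/eqP->; rewrite eqxx ?andbF.
rewrite ltnS => lt_q /esym/norP[-> ->]; rewrite (std_idx kq) eqSS /=.
have -> : u.1 = nth o (unzip1 hs) p by rewrite (nth_map u) // nth_p.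
by rewrite nth_uniq ?size_map // (unzip1_uniq hs_sorted).
Qed.

Lemma mxtraceM1 (F : fieldType) d (A C : 'M[F]_d) :
  d = 1%N -> \tr (A *m C) = \tr A * \tr C.
Proof.
move=> d1; subst d.
by rewrite [A]mx11_scalar [C]mx11_scalar -scalar_mxM !mxtrace_scalar.
Qed.

(** Both sides are multiplicative, the trace because the degree is 1, so [young_ind] leaves
    transpositions inside a block. *)
Lemma kact_young s : s \in Y -> kact s e0 = \tr (M s) *: e0.
Proof.
pose P s := kact s e0 = \tr (M s) *: e0.
apply: (young_ind sum_c (P := P)) => {s}[|k l s kl idx_kl Ys IHs]; rewrite /P.
  by rewrite kact_id repr_mx1 mxtrace1 rdegree_young_module scale1r.
have Yt := tperm_young sum_c idx_kl.
rewrite kact_mul // repr_mxM // (mxtraceM1 _ _ (rdegree_young_module x n hs)).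
suff -> : kact (tperm k l) e0 = \tr (M (tperm k l)) *: e0.
  by rewrite kactZ // IHs scalerA.
rewrite (mxtrace_young_tperm x sum_hs kl idx_kl).
case kp : (idx k) => [|p].
  rewrite big_pred0_eq scale1r.
  (* Block 0 has just two points, hence a single transposition. *)
  have tE : tperm i0 j0 = tperm k l.
    have := idx_eq0 k; have := idx_eq0 l; rewrite -idx_kl kp eqxx.
    move=> /esym/orP[]/eqP lE /esym/orP[]/eqP kE; move: kl; rewrite lE kE ?eqxx //.
    by rewrite tpermC.
  rewrite -tE kact_tperm_pair ?neq_i0j0 // ffunE eqxx eq_sym (negPf neq_i0j0).
  exact: xo.
have lt_p : (p < size hs)%N.
  by have := reshape_index_size sum_c k; rewrite /= size_map kp.
have lp : idx l = p.+1 by rewrite -idx_kl.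
have := idx_eq0 k; have := idx_eq0 l; rewrite kp lp.
move=> /esym/norP[li lj] /esym/norP[ki kj].
rewrite kact_tperm_kmonoG // ?(std_idx kp) ?(std_idx lp) //.
rewrite (big_pred1 (Ordinal lt_p)) /=; last by move=> q; rewrite eqSS eq_sym.
by rewrite (tnth_nth (o, 0%N)) /= (nth_map (o, 0%N)).
Qed.

(** Monomials of the strand need an increasing pair. The correction by [tperm i0 j0] changes neither
    the coset of the Young subgroup nor the translate of [e0]. *)
Definition ascending s : 'S_n := if (s i0 < s j0)%N then s else (tperm i0 j0 * s)%g.

Lemma tperm_pair_young : tperm i0 j0 \in Y.
Proof.
apply: (tperm_young sum_c); transitivity 0%N.
  by apply/eqP; rewrite idx_eq0 eqxx.
by apply/esym/eqP; rewrite idx_eq0 eqxx orbT.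
Qed.

Lemma ascending_lt s : (ascending s i0 < ascending s j0)%N.
Proof.
rewrite /ascending; case: ifP => //.
rewrite !permM tpermL tpermR => /negbT; rewrite -leqNgt leq_eqVlt.
by rewrite (inj_eq val_inj) (inj_eq perm_inj) eq_sym (negPf neq_i0j0).
Qed.

Lemma ascending_young s : (ascending s * s^-1)%g \in Y.
Proof.
rewrite /ascending; case: ifP => _; first by rewrite mulgV group1.
by rewrite mulgK tperm_pair_young.
Qed.

Lemma kact_ascending s : kact (ascending s) e0 = kact s e0.
Proof.
rewrite /ascending; case: ifP => // _; rewrite kact_mul //.
rewrite kact_tperm_pair ?neq_i0j0 // ffunE eqxx eq_sym (negPf neq_i0j0).
exact: xo.
Qed.

(** The classes in [hs] are distinct, so outside the pair the class determines the block; the pair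
    itself is fixed by assumption. *)
Lemma std_stab_young s :
  s i0 = i0 -> s j0 = j0 ->
  (forall k, std_classes (s k) = std_classes k) -> s \in Y.
Proof.
move=> si sj s_std; apply/(youngP sum_c) => k.
have idx_s : (idx (s k) == 0%N) = (idx k == 0%N).
  by rewrite !idx_eq0 -{1}si -{1}sj !(inj_eq perm_inj).
have lt_sk := reshape_index_size sum_c (s k).
have lt_k := reshape_index_size sum_c k.
move: idx_s (s_std k) lt_sk lt_k; rewrite /= size_map.
case skp: (idx (s k)) => [|p]; case kq: (idx k) => [|q] // _.
rewrite (std_idx skp) (std_idx kq) !ltnS => pq lt_p lt_q; congr _.+1.
by apply/eqP; rewrite -(nth_uniq o _ _ (unzip1_uniq hs_sorted)) ?size_map ?pq.
Qed.

Local Notation rc := (@coset_rep _ Y).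

Lemma coset_rep_inj i j : (rc i * (rc j)^-1)%g \in Y -> i = j.
Proof.
have [l Hl] := coset_repP 1 i; have := Hl i; have := Hl j.
by rewrite !mulg1 mulgV group1 => -> /esym/eqP -> /eqP.
Qed.

Lemma coset_rep_cover s : exists i, (s * (rc i)^-1)%g \in Y.
Proof.
have Ys : (Y :* s)%g \in rcosets Y [set: 'S_n] by apply/rcosetsP; exists s.
exists (enum_rank_in Ys (Y :* s)%g); rewrite -groupV invMg invgK.
by rewrite -mem_rcoset /coset_rep enum_rankK_in // mem_repr_rcoset.
Qed.

Lemma kact_coset_free (c : 'I_#|rcosets Y [set: 'S_n]| -> rat) :
  \sum_i c i *: kact (rc i) e0 = 0 -> forall i, c i = 0.
Proof.
move=> sum0 i; pose t r := ascending (rc r).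
(* The functional dual to the monomial underlying the translate [i]; it kills all other
   translates. *)
pose K := kcoef x o (t i i0) (t i j0) (permute std_classes (t i)).
have neq_t : t i i0 != t i j0 by rewrite neq_ltn ascending_lt.
have K_linear a u v : K (a *: u + v) = a * K u + K v.
  exact: (kcoef_linear x o m_gt0 neq_t (permute std_classes (t i))).
have K0 : K 0 = 0.
  by have := K_linear (-1) 0 0; rewrite scaler0 addr0 mulN1r addNr.
have KE r : exists e : nat, K (kact (rc r) e0) = (-1) ^+ e * (r == i)%:R.
  have [e te] := kact_kmonoG x m_gt0 (t r) std_classes i0 j0.
  exists e; rewrite -kact_ascending te -[X in K X]addr0 K_linear K0 addr0.
  rewrite /K kcoef_mono ?ascending_lt //; last first.
    by rewrite permuteE ffunE eqxx eq_sym (negPf neq_i0j0).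
  congr (_ * (nat_of_bool _)%:R); apply/eqP/eqP => [[t_std ti tj]|-> //].
  (* Equal monomials differ by a stabiliser of the standard configuration, so the two
     representatives define the same coset. *)
  have : (t r * (t i)^-1)%g \in Y.
    apply: std_stab_young; rewrite ?permM ?ti ?tj ?permK // => k.
    have /ffunP/(_ (t r k)) := t_std.
    by rewrite permuteE [in RHS]ffunE => ->; rewrite ?permM.
  rewrite -(groupMl _ (groupVr (ascending_young (rc r)))).
  rewrite -(groupMr _ (ascending_young (rc i))).
  by rewrite invMg invgK !mulgA !mulgKV => /coset_rep_inj.
have := congr1 K sum0; rewrite K0.
have -> : K (\sum_r c r *: kact (rc r) e0) = \sum_r c r * K (kact (rc r) e0).
  elim/big_rec2: _ => // r u v _ <-; exact: K_linear.
rewrite (bigD1 i) //= big1 => [|r /negPf li].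
  have [e ->] := KE i; rewrite eqxx mulr1 addr0 => /eqP.
  by rewrite mulf_eq0 signr_eq0 orbF => /eqP.
by have [e ->] := KE r; rewrite li !mulr0.
Qed.

(** By transitivity each monomial is, up to sign, a translate of [e0], and the Young character
    reduces it to a coset representative. Conversely, ascending representatives give monomials with
    an increasing pair. *)
Lemma strand_coset v : strand x h1 hs v <->
  exists c : 'I_#|rcosets Y [set: 'S_n]| -> rat, v = \sum_i c i *: kact (rc i) e0.
Proof.
split.
  apply: (@lin_span_trans _ _ _ _ _ xpredT _ (fun i => kact (rc i) e0)).
  case=> a [i j] /= a_type.
  have [s [si sj sa]] := of_type_conj xo hs_sorted sum_hs std_type a_type.
  have [e] := kact_kmonoG x m_gt0 s std_classes i0 j0; rewrite si sj sa => s_e0.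
  have -> : kmono x a * kG X i j = (-1) ^+ e *: kact s e0.
    by rewrite s_e0 scalerA -exprD addnn -signr_odd odd_double scale1r.
  have [r Yr] := coset_rep_cover s.
  have -> : kact s e0 = \tr (M (s * (rc r)^-1)%g) *: kact (rc r) e0.
    by rewrite -kactZ // -kact_young // -kact_mul // mulgKV.
  by rewrite scalerA; apply: lin_span_gen.
apply: lin_span_trans => i _.
rewrite -kact_ascending.
have [e ->] := kact_kmonoG x m_gt0 (ascending (rc i)) std_classes i0 j0.
pose t := ascending (rc i); pose u := (permute std_classes t, (t i0, t j0)).
apply: (@lin_span_gen _ _ _ _ (fun u : {ffun 'I_n -> 'I_B} * ('I_n * 'I_n) =>
   kmono x u.1 * kG X u.2.1 u.2.2) _ u).
by apply: (of_type_permute xo); [exact: ascending_lt | exact: std_type].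
Qed.

End StandardConfiguration.

Theorem proposition3p4 (m n : nat) (X : cohomology m) (B : nat)
    (x : ordered_basis X B) (h1 : 'I_B) (hs : seq ('I_B * nat)) :
  (1 <= m)%N -> (2 <= n)%N ->
  sorted (fun u v : 'I_B * nat => (v.1 < u.1)%N) hs ->
  all (fun u : 'I_B * nat => (1 <= u.2)%N) hs ->
  (2 + sumn (unzip2 hs))%N = n ->
  submodule_iso (@kact m X n) (@strand m X B x n h1 hs)
    (ind_repr (young_module x n hs)).
Proof.
move=> m_gt0 n_gt1 hs_sorted _ sum_hs.
(* The existence of [h1] makes the basis nonempty, so index 0, that of the unit, is available. *)
pose o : 'I_B := Ordinal (leq_ltn_trans (leq0n h1) (ltn_ord h1)).
have xo : x o = 1 by apply: bas_first.
pose i0 : 'I_n := Ordinal (ltnW n_gt1); pose j0 : 'I_n := Ordinal n_gt1.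
pose e := kmonoG x (std_classes h1 o hs i0 j0) i0 j0.
apply: (@submodule_iso_ind _ _ _ _ _ _ _ _ _ e).
- by move=> s a u v; apply: kact_linear.
- by move=> s t v; apply: kact_mul.
- exact: rdegree_young_module.
- exact: kact_young.
- exact: kact_coset_free.
- exact: strand_coset.
Qed.
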